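(* Suppose $\lim_{N\to\infty}M/N=\gamma$. Then the sequence of invariant probability distributions $\bar y^N$ of the processes $(Y^N_t)_{t\ge0}$ converges weakly, as $N\to\infty$, to the Dirac mass at $\bar y$, where $\bar y$ is the unique equilibrium point of the mean field limit, i.e. the unique probability vector $\bar y$ on $\{0,\dots,K\}$ with $b(\bar y)=0$.
   Context: Fix an integer $K\ge 1$ (station capacity), $\lambda>0$, $p\in[0,1]$, and an arbitrary non-decreasing, non-negative function $g$ (choice function). For each $N\ge1$ there are $N$ stations and a fleet of $M=M_N$ bikes. $X_i(t)\in\{0,\dots,K\}$ is the number of bikes at station $i$ at time $t$. The vector $(X_1(t),\dots,X_N(t))$ is a continuous-time Markov chain: $X_i$ increases by 1 at rate $\frac1N\big(M-\sum_{k=1}^N X_k(t)\big)\mathbf 1\{X_i(t)<K\}$ and decreases by 1 at rate $\big((1-p)\lambda+p\lambda N\frac{g(X_i(t))}{\sum_{j=1}^N g(X_j(t))}\big)\mathbf 1\{X_i(t)>0\}$. The empirical process is $Y^N_t=(Y^N_t(0),\dots,Y^N_t(K))$, $Y^N_t(n)=\frac1N\sum_{i=1}^N\mathbf 1\{X_i(t)=n\}$, a continuous-time Markov chain with transition rates $Q^N\big(y,y+\tfrac1N(\mathbf 1_{n-1}-\mathbf 1_n)\big)=\lambda N y_n\big((1-p)+p\frac{g(n)}{\sum_{j}y_jg(j)}\big)\mathbf 1_{n>0}$ and $Q^N\big(y,y+\tfrac1N(\mathbf 1_{n+1}-\mathbf 1_n)\big)=N y_n\big(\frac MN-\sum_{j}jy_j\big)\mathbf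 1_{n<K}$. Its invariant probability distribution $\bar y^N$ is a probability measure on the set of probability vectors on $\{0,\dots,K\}$. The mean field limit is the dynamical system $\dot y=b(y)$ with $$b(y)=\sum_{n=0}^{K}\Big[\Big((1-p)+p\frac{g(n)}{\sum_{j=0}^{K}y_j g(j)}\Big)\lambda(\mathbf 1_{n-1}-\mathbf 1_n)\mathbf 1_{n>0}+\Big(\gamma-\sum_{j=0}^{K}j y_j\Big)(\mathbf 1_{n+1}-\mathbf 1_n)\mathbf 1_{n<K}\Big]y_n,$$ where $\mathbf 1_n$ is the $n$-th standard unit vector of $\mathbb R^{K+1}$ (coordinates indexed $0,\dots,K$).
   Formalization: Two assumptions are added: if p>0 then g(n)>0 for all n≥1 (otherwise some transition rates are 0/0), and if g(0)=0 then γ=0 or γ>pλ (if g(0)=0, p>0 and 0<γ≤pλ, the mean field limit has no equilibrium point). *)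

(* Defs.v *)
From HB Require Import structures.
From mathcomp Require Import all_boot all_order all_algebra.
From mathcomp Require Import all_classical all_reals all_analysis.
Set Implicit Arguments.
Unset Strict Implicit.
Unset Printing Implicit Defensive.
Import Order.TTheory GRing.Theory Num.Theory.
Import numFieldNormedType.Exports.
Local Open Scope classical_set_scope.
Local Open Scope ring_scope.

(** * Weak convergence of Borel probability measures on R^n *)

Definition borel (R : realType) (n : nat) :=
  g_sigma_algebraType (@open 'rV[R]_n).

Definition converges_weakly (R : realType) (n : nat)
    (mu : nat -> probability (borel R n) R) (nu : probability (borel R n) R) :=
  forall f : 'rV[R]_n -> R, continuous f ->
    (exists C : R, forall x, `|f x| <= C) ->
    (\int[mu N]_x (f x)%:E)%E @[N --> \oo] --> (\int[nu]_x (f x)%:E)%E.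

(** * Continuous-time Markov chains on a finite state space *)

(** [P t i j] is the probability of being in [j] at time [t] when starting
    from [i]; [q i j], for [i != j], is the rate of the transition from [i] to
    [j] (the diagonal of [q] is ignored: since the rows of [P h] sum to 1, the
    derivative of [P h i i] at 0 is minus the total rate out of [i]). *)
Definition has_transition_rates (R : realType) (S : finType)
    (q : S -> S -> R) (P : R -> S -> S -> R) : Prop :=
  [/\ forall t i j, 0 <= t -> 0 <= P t i j,
      forall t i, 0 <= t -> \sum_j P t i j = 1,
      forall i j, P 0 i j = (i == j)%:R,
      forall s t i j, 0 <= s -> 0 <= t ->
        P (s + t) i j = \sum_k P s i k * P t k j
    & forall i j, i != j -> h^-1 * P h i j @[h --> 0^'+] --> q i j].

(** [nu] is an invariant distribution of the chain whose state [i] is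
    represented by the vector [Y i]. *)
Definition invariant_distribution (R : realType) (n : nat) (S : finType)
    (Y : S -> 'rV[R]_n) (P : R -> S -> S -> R)
    (nu : probability (borel R n) R) : Prop :=
  nu (range Y) = 1%E /\
  forall t j, 0 <= t ->
    \sum_i fine (nu [set Y i]) * P t i j = fine (nu [set Y j]).

(** * The bike-sharing model *)

Definition is_prob_vec (R : realType) (K : nat) (y : 'rV[R]_K.+1) : Prop :=
  (forall n, 0 <= y 0 n) /\ \sum_n y 0 n = 1.

(** The vectors 1_{n-1} - 1_n and 1_{n+1} - 1_n.  They are meaningless at
    n = 0 and n = K respectively, where they only occur multiplied by 0. *)
Definition step_down (R : realType) (K : nat) (n : 'I_K.+1) : 'rV[R]_K.+1 :=
  delta_mx 0 (inord n.-1) - delta_mx 0 n.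

Definition step_up (R : realType) (K : nat) (n : 'I_K.+1) : 'rV[R]_K.+1 :=
  delta_mx 0 (inord n.+1) - delta_mx 0 n.

(** Rate at which a given station holding [n] bikes loses one.  The quotient
    has denominator 0 only if [g] vanishes at every level [n] with
    [y 0 n > 0]; when [g] is positive at all positive levels, this happens only
    if all stations are empty, and the value 0 it then has by convention is
    always multiplied by 0 in what follows. *)
Definition departure (R : realType) (K : nat) (lambda p : R)
    (g : 'I_K.+1 -> R) (y : 'rV[R]_K.+1) (n : 'I_K.+1) : R :=
  lambda * ((1 - p) + p * (g n / \sum_j y 0 j * g j)).

(** Rate at which a given station receives bikes when there are [m] bikes per
    station in total. *)
Definition arrival (R : realType) (K : nat) (m : R) (y : 'rV[R]_K.+1) : R :=
  m - \sum_(j < K.+1) j%:R * y 0 j.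

(** A state is given by the number [c n] of stations holding [n] bikes, for
    each [n]; there are [N] stations, and no more than [M] bikes in total. *)
Definition state (K N M : nat) :=
  {c : {ffun 'I_K.+1 -> 'I_N.+1} |
    (\sum_(n < K.+1) c n == N)%N && (\sum_(n < K.+1) n * c n <= M)%N}.

Definition profile (R : realType) (K N M : nat) (c : state K N M) :
    'rV[R]_K.+1 :=
  \row_n ((val c n)%:R / N%:R).

(** For [y != z] at most one of the summands is nonzero, since the vectors
    1_{n-1} - 1_n (n > 0) and 1_{n+1} - 1_n (n < K) are pairwise distinct. *)
Definition rate (R : realType) (K : nat) (lambda p : R) (g : 'I_K.+1 -> R)
    (N M : nat) (y z : 'rV[R]_K.+1) : R :=
  \sum_(n < K.+1)
    ((z == y + N%:R^-1 *: step_down R n)%:R *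
       (N%:R * y 0 n * departure lambda p g y n * (0 < n)%N%:R) +
     (z == y + N%:R^-1 *: step_up R n)%:R *
       (N%:R * y 0 n * arrival (M%:R / N%:R) y * (n < K)%N%:R)).

Definition state_rate (R : realType) (K : nat) (lambda p : R)
    (g : 'I_K.+1 -> R) (N M : nat) (c c' : state K N M) : R :=
  rate lambda p g N M (profile R c) (profile R c').

(** The mean field vector field b. *)
Definition drift (R : realType) (K : nat) (lambda p gamma : R)
    (g : 'I_K.+1 -> R) (y : 'rV[R]_K.+1) : 'rV[R]_K.+1 :=
  \sum_(n < K.+1)
    y 0 n *: ((departure lambda p g y n * (0 < n)%N%:R) *: step_down R n +
              (arrival gamma y * (n < K)%N%:R) *: step_up R n).

Definition is_equilibrium (R : realType) (K : nat) (lambda p gamma : R)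
    (g : 'I_K.+1 -> R) (y : 'rV[R]_K.+1) : Prop :=
  is_prob_vec y /\ drift lambda p gamma g y = 0.

(* Main.v *)
(** Let [u k = y_k + ... + y_K] be the tails of a profile [y], and [a] the
    number of bikes in transit per station.  In the coordinates [(a, u 1, ...,
    u K)], whose sum is conserved, the mean field dynamics is cooperative, so
    the l1-distance to an equilibrium does not increase; and since [a] feeds
    every level directly, it decreases at a rate proportional to the deviation
    of [a].  Once that deviation is controlled, the l1-distance of the tails
    weighted by a steeply decreasing function of the level decreases at a rate
    proportional to itself.  Applied with a smoothed absolute value to the
    generator of the chain, whose mean vanishes under the invariant law, these
    two facts bound the mean distance to the equilibrium by a quantity tending
    to 0; applied to another equilibrium, they give uniqueness.  Existence
    follows from the intermediate value theorem used twice: first for the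
    number of bikes in transit, given the mean weight [sum_j y_j g(j)], and
    then for that mean weight. *)

Require Import Defs.
From HB Require Import structures.
From mathcomp Require Import all_boot all_order all_algebra.
From mathcomp Require Import all_classical all_reals all_analysis.
From mathcomp Require Import measurable_realfun ring lra.
Import Order.TTheory GRing.Theory Num.Theory.
Import numFieldNormedType.Exports.
Local Open Scope classical_set_scope.
Local Open Scope ring_scope.

(** * Cooperative conservative flows *)

(** Cooperativity has a single source. The stations are coupled through the denominator
    [\sum_j y_j g(j)]; as [g] is non-decreasing, raising a tail can only raise this sum, slow the
    departures elsewhere and so push the other tails up. Read on deviations from the equilibrium,
    the dynamics is then a jump process: deviation moves one level up, one level down, or is
    redistributed according to the service shares, and what leaves the levels goes to the bikes in
    transit. Jumps between places where the deviation has the same sign leave the plain l1-distance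
    unchanged, so it gives no rate for the tails; the weighted distance does, but may grow with the
    deviation of the bikes in transit. Hence two distances, in this order. Averaging the generator
    under the invariant law avoids following trajectories. Jumps of size [1/N] see the kink of the
    absolute value; smoothing it at scale [d] costs order [d] in the sign and [1/(N d)] in the
    second-order term. A last error [|M/N - gamma|] appears because the chain and the equilibrium do
    not hold the same number of bikes per station. *)

Lemma le_last {R : realFieldType} (K : nat) (g : nat -> R) (i : nat) :
  (forall j, (j < K)%N -> g j <= g j.+1) -> (i <= K)%N -> g i <= g K.
Proof.
elim: K => [|k IH] gm; first by rewrite leqn0 => /eqP->.
rewrite leq_eqVlt => /orP[/eqP->//|]; rewrite ltnS => ik.
by apply: le_trans (gm k _) => //; apply: IH ik => j jk; apply: gm; rewrite ltnW.
Qed.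

(* The indices [0] and [K.+1] of [x], [s] and [t] both stand for the bikes in
   transit, whose deviation from the equilibrium is [xa]. *)
Definition net_flow {R : pzRingType} (K : nat) (x g yb q : nat -> R)
    (xa a l sg : R) (i : nat) : R :=
  xa * yb i + a * (x i - x i.+1)
  - (l + sg * g i.+1) * (x i.+1 - x i.+2)
  + sg * q i.+1 * \sum_(j < K) (g j.+1 - g j) * x j.+1.

(** Summation by parts, moving the flow onto the test vector [t]. The coefficient of [x i.+1] has
    the form of a generator applied to [t]: jumps to [i.+2] at rate [a], to [i] at rate
    [l + sg * g i], and to index [k] with probability [q k] at rate [sg * (g i.+1 - g i)]. The
    condition [t K.+1 = t 0] identifies both ends with the bikes in transit. *)
Lemma flow_identity {R : comPzRingType} (K : nat) (x t g yb q : nat -> R)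
    (xa a l sg : R) :
  x 0%N = 0 -> x K.+1 = 0 -> t K.+1 = t 0%N ->
  \sum_(i < K) (t i.+1 - t 0%N) * net_flow K x g yb q xa a l sg i =
  xa * (\sum_(i < K) yb i * (t i.+1 - t 0%N)) +
  \sum_(i < K) x i.+1 *
    (a * (t i.+2 - t i.+1) + (l + sg * g i) * (t i - t i.+1)
     + sg * (g i.+1 - g i) *
       (\sum_(k < K) q k.+1 * (t k.+1 - t 0%N) - (t i.+1 - t 0%N))).
Proof.
move=> x0 xK tK; rewrite /net_flow.
set S := \sum_(j < K) (g j.+1 - g j) * x j.+1.
set Q := \sum_(k < K) q k.+1 * (t k.+1 - t 0%N).
(* The boundary term of the summation by parts: it vanishes at 0 because of [t 0 - t 0] and
   [x 0 = 0], and at [K] because [x K.+1 = 0] and [t K.+1 = t 0]. *)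
pose W i := (t i - t 0%N) * (l + sg * g i) * x i.+1 - a * (t i.+1 - t 0%N) * x i.
have W0 : \sum_(i < K) (W i.+1 - W i) = 0.
  rewrite -(big_mkord xpredT (fun i => W i.+1 - W i)) telescope_sumr // /W.
  by rewrite x0 xK tK !subrr !(mulr0, mul0r) !subrr.
rewrite (eq_bigr (fun i : 'I_K => xa * (yb i * (t i.+1 - t 0%N)) +
   (W i.+1 - W i) + sg * S * (q i.+1 * (t i.+1 - t 0%N)) +
   x i.+1 * (a * (t i.+2 - t i.+1) + (l + sg * g i) * (t i - t i.+1)
     - sg * (g i.+1 - g i) * (t i.+1 - t 0%N)))); last first.
  by move=> i _; rewrite /W; ring.
do 3 rewrite big_split /=; rewrite W0 addr0.
rewrite -!mulr_sumr -addrA; congr (_ + _).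
rewrite -/Q -mulrA [S * Q]mulrC mulrA /S mulr_sumr -big_split /=.
by apply: eq_bigr => i _; ring.
Qed.

(** The test vector is [h * s], where [s] is nearly the sign of [x]. As [|s i| <= 1], a unit of
    deviation that jumps from [j.+1] to [k] changes its weight by at most [h k - h j.+1]; the defect
    [d] of the sign at the starting point adds [h j.+1 * d]. All jump rates are nonnegative, so
    these bounds may be summed. *)
Lemma flow_bound {R : realFieldType} (K : nat) (x s h g yb q : nat -> R)
    (xa a l sg d : R) :
  x 0%N = 0 -> x K.+1 = 0 -> s K.+1 = s 0%N -> h K.+1 = h 0%N ->
  0 <= a -> 0 <= l -> 0 <= sg ->
  (forall i, 0 <= g i) -> (forall i, (i < K)%N -> g i <= g i.+1) ->
  (forall i, 0 <= q i) -> \sum_(i < K) q i.+1 <= 1 ->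
  (forall i, 0 <= h i) -> (forall i, `|s i| <= 1) ->
  (forall i, `|x i| - s i * x i <= d) ->
  \sum_(i < K) (h i.+1 * s i.+1 - h 0%N * s 0%N) * net_flow K x g yb q xa a l sg i <=
  xa * (\sum_(i < K) yb i * (h i.+1 * s i.+1 - h 0%N * s 0%N)) +
  \sum_(i < K) (`|x i.+1| *
    (a * (h i.+2 - h i.+1) + (l + sg * g i) * (h i - h i.+1)
     + sg * (g i.+1 - g i) *
       (\sum_(k < K) q k.+1 * (h k.+1 - h 0%N) - (h i.+1 - h 0%N)))
   + (a + (l + sg * g i.+1)) * (h i.+1 * d)).
Proof.
move=> x0 xK sK hK a0 l0 sg0 g0 gmono q0 q1 h0 s1 xd.
rewrite (@flow_identity _ _ x (fun i => h i * s i)) ?sK ?hK //.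
rewrite lerD2l; apply: ler_sum => j _.
set t := fun i => h i * s i.
have key i : x j.+1 * (t i - t j.+1) <= `|x j.+1| * (h i - h j.+1) + h j.+1 * d.
  rewrite /t; have xs : x j.+1 * s i <= `|x j.+1|.
    by rewrite (le_trans (ler_norm _)) // normrM ler_piMr.
  have := ler_wpM2l (h0 i) xs; have := ler_wpM2l (h0 j.+1) (xd j.+1).
  move=> *; lra.
(* Sending the missing mass [1 - \sum_k q k.+1] to index 0 turns the redistribution into a convex
   combination of jumps out of [j.+1], to each of which [key] applies. *)
have Eq (u : nat -> R) :
  \sum_(k < K) q k.+1 * (u k.+1 - u 0%N) - (u j.+1 - u 0%N) =
  \sum_(k < K) q k.+1 * (u k.+1 - u j.+1)
    + (1 - \sum_(k < K) q k.+1) * (u 0%N - u j.+1).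
  rewrite mulrBl mul1r mulr_suml.
  have -> : \sum_(k < K) q k.+1 * (u k.+1 - u 0%N) =
    \sum_(k < K) q k.+1 * (u k.+1 - u j.+1)
      - \sum_(i < K) q i.+1 * (u 0%N - u j.+1).
    by rewrite -sumrB; apply: eq_bigr => k _; ring.
  ring.
have keyQ : x j.+1 *
    (\sum_(k < K) q k.+1 * (t k.+1 - t 0%N) - (t j.+1 - t 0%N)) <=
    `|x j.+1| * (\sum_(k < K) q k.+1 * (h k.+1 - h 0%N) - (h j.+1 - h 0%N))
    + h j.+1 * d.
  rewrite !Eq.
  have -> : h j.+1 * d = \sum_(k < K) q k.+1 * (h j.+1 * d)
       + (1 - \sum_(k < K) q k.+1) * (h j.+1 * d).
    by rewrite -mulr_suml; ring.
  rewrite !mulrDr addrACA; apply: lerD.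
    rewrite !mulr_sumr -big_split; apply: ler_sum => k _ /=.
    by have := ler_wpM2l (q0 k.+1) (key k.+1); lra.
  have q1' : 0 <= 1 - \sum_(k < K) q k.+1 by lra.
  by have := ler_wpM2l q1' (key 0%N); lra.
have mb0 : 0 <= l + sg * g j by rewrite addr_ge0 // mulr_ge0.
have dg : 0 <= sg * (g j.+1 - g j) by rewrite mulr_ge0 // subr_ge0 gmono.
have := ler_wpM2l a0 (key j.+2).
have := ler_wpM2l mb0 (key j).
have := ler_wpM2l dg keyQ.
rewrite -/(t j.+1) -/(t j) -/(t j.+2).
move: (\sum_(k < K) _ - (t j.+1 - _)) (\sum_(k < K) _ - (h j.+1 - _)) => A B.
lra.
Qed.

(** With constant weights every jump is neutral, and only the direct feeding of the levels by [xa]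
    is left. Conservation of the total, up to [e], forces some level to deviate against [xa] unless
    [|xa| <= |e|]; feeding that level gains at least [c * |xa|], while no other level loses more
    than [d]. *)
Lemma hub_bound {R : realFieldType} (K : nat) (x s g yb q : nat -> R)
    (xa a l sg d c e : R) :
  x 0%N = 0 -> x K.+1 = 0 -> s K.+1 = s 0%N ->
  0 <= a -> 0 <= l -> 0 <= sg ->
  (forall i, 0 <= g i) -> (forall i, (i < K)%N -> g i <= g i.+1) ->
  (forall i, 0 <= q i) -> \sum_(i < K) q i.+1 <= 1 ->
  (forall i, `|s i| <= 1) -> (forall i, `|x i| - s i * x i <= d) ->
  `|xa| - s 0%N * xa <= d ->
  (forall i, (i < K)%N -> x i.+1 <= 0 -> s i.+1 <= 0) ->
  (forall i, (i < K)%N -> 0 <= x i.+1 -> 0 <= s i.+1) ->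
  0 <= c -> (forall i, (i < K)%N -> c <= yb i <= 1) ->
  \sum_(i < K) x i.+1 + xa = e ->
  \sum_(i < K) (s i.+1 - s 0%N) * net_flow K x g yb q xa a l sg i <=
  - c * `|xa| + c * `|e| + K%:R * (1 + a + (l + sg * g K)) * d.
Proof.
move=> x0 xK sK a0 l0 sg0 g0 gmono q0 q1 s1 xd xad sneg spos c0 cyb xsum.
have d0 : 0 <= d by have := xd 0%N; rewrite x0 normr0 mulr0 subr0.
have gK i : (i <= K)%N -> g i <= g K by exact: le_last.
have := @flow_bound R K x s (fun=> 1) g yb q xa a l sg d x0 xK sK erefl
  a0 l0 sg0 g0 gmono q0 q1 (fun=> ler01) s1 xd.
rewrite (eq_bigr (fun i : 'I_K => (s i.+1 - s 0%N) * net_flow K x g yb q xa a l sg i));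
  last by move=> i _; rewrite !mul1r.
move/le_trans; apply.
have term i : xa * (s i - s 0%N) <= d.
  have : xa * s i <= `|xa|.
    by rewrite (le_trans (ler_norm _)) // normrM ler_piMr.
  by lra.
have E1 : xa * (\sum_(i < K) yb i * (1 * s i.+1 - 1 * s 0%N)) <=
    - c * `|xa| + c * `|e| + K%:R * d.
  have [xe|xe] := lerP `|xa| `|e|.
    apply: (@le_trans _ _ (K%:R * d)); last by have := ler_wpM2l c0 xe; lra.
    rewrite mulr_sumr -[K in K%:R]card_ord mulr_natl -sumr_const.
    apply: ler_sum => i _; rewrite !mul1r mulrCA.
    have /andP[cy y1] := cyb i (ltn_ord i).
    have y0 : 0 <= yb i by lra.
    by have := ler_wpM2l y0 (term i.+1); have := ler_wpM2r d0 y1; lra.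
  (* Otherwise every [x i.+1] has the sign of [xa], so [xa * (e - xa)] is nonnegative, which
     contradicts [|e| < |xa|]. *)
  have [i Pi] : exists i : 'I_K, xa * s i.+1 <= 0.
    apply/existsP; rewrite -[X in is_true X]negbK; apply/negP => /existsPn h.
    have h' (i : 'I_K) : 0 < xa * s i.+1 by have := h i; rewrite -ltNge.
    have : 0 <= \sum_(i < K) xa * x i.+1.
      apply: sumr_ge0 => i _.
      have := h' i; case: (ltgtP xa 0) => xas.
      - rewrite nmulr_rgt0 // => si; rewrite nmulr_rge0 //.
        by case: (lerP (x i.+1) 0) => // /ltW /(spos _ (ltn_ord i)); lra.
      - rewrite pmulr_rgt0 // => si; rewrite pmulr_rge0 //.
        by case: (lerP 0 (x i.+1)) => // /ltW /(sneg _ (ltn_ord i)); lra.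
      - by rewrite xas mul0r ltxx.
    rewrite -mulr_sumr; have -> : \sum_(i < K) x i.+1 = e - xa by lra.
    rewrite mulrBr subr_ge0 -expr2 -real_normK ?num_real // => h2.
    have := ler_norm (xa * e); rewrite normrM => h3.
    have xa_gt0 : 0 < `|xa| by apply: le_lt_trans xe.
    have := ltr_pM2l xa_gt0 `|e| `|xa|; rewrite xe => h4.
    have: `|xa| ^+ 2 <= `|xa| * `|e| by lra.
    by rewrite expr2 leNgt h4.
  have /andP[cy y1] := cyb i (ltn_ord i).
  rewrite mulr_sumr; under eq_bigr do rewrite !mul1r.
  rewrite (bigD1 i) //=.
  have Ei : xa * (yb i * (s i.+1 - s 0%N)) <= - c * `|xa| + d.
    rewrite mulrCA.
    have h1 : xa * (s i.+1 - s 0%N) <= d - `|xa| by lra.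
    have y0 : 0 <= yb i by lra.
    have := ler_wpM2l y0 h1; have := ler_wpM2r d0 y1.
    have := ler_wpM2r (normr_ge0 xa) cy; lra.
  have Er : \sum_(j < K | j != i) xa * (yb j * (s j.+1 - s 0%N)) <= (K%:R - 1) * d.
    apply: (@le_trans _ _ (\sum_(j < K | j != i) d)).
      apply: ler_sum => j _; rewrite mulrCA.
      have /andP[cyj y1j] := cyb j (ltn_ord j).
      have y0 : 0 <= yb j by lra.
      by have := ler_wpM2l y0 (term j.+1); have := ler_wpM2r d0 y1j; lra.
    have : \sum_(j < K) d = K%:R * d by rewrite sumr_const card_ord mulr_natl.
    by rewrite (bigD1 i) //=; lra.
  have := mulr_ge0 c0 (normr_ge0 e); lra.
have E2 : \sum_(i < K) (`|x i.+1| *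
     (a * (1 - 1) + (l + sg * g i) * (1 - 1) + sg * (g i.+1 - g i) *
       (\sum_(k < K) q k.+1 * (1 - 1) - (1 - 1)))
   + (a + (l + sg * g i.+1)) * (1 * d)) <= K%:R * (a + (l + sg * g K)) * d.
  rewrite -mulrA mulr_natl -[K in _ *+ K]card_ord -sumr_const.
  apply: ler_sum => i _; rewrite !subrr !(mulr0, add0r, subr0).
  rewrite [\sum_(_ < _) _]big1 ?mulr0 ?add0r ?mul1r; last by move=> k _; rewrite mulr0.
  by apply: ler_wpM2r => //; rewrite !lerD2l ler_wpM2l ?gK.
by apply: le_trans (lerD E1 E2) _; lra.
Qed.

(* The differences of consecutive terms grow geometrically, so that for the
   weights [weight B a K] below the moves by one level up at rate [a], which
   decrease the weight, dominate all others, of total rate at most [B]. *)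
Fixpoint gap_sum {R : realFieldType} (B a : R) (n : nat) : R :=
  if n is m.+1 then gap_sum B a m + (B * gap_sum B a m + 1) / a else 0.

Lemma gap_sum_ge0 {R : realFieldType} (B a : R) (n : nat) :
  0 <= B -> 0 < a -> 0 <= gap_sum B a n.
Proof.
move=> B0 a0; elim: n => //= n IH.
by rewrite addr_ge0 // divr_ge0 ?ltW // ltr_wpDl // mulr_ge0.
Qed.

Lemma gap_sum_le {R : realFieldType} (B a : R) (m n : nat) :
  0 <= B -> 0 < a -> (m <= n)%N -> gap_sum B a m <= gap_sum B a n.
Proof.
move=> B0 a0; elim: n => [|n IH]; first by rewrite leqn0 => /eqP->.
rewrite leq_eqVlt => /orP[/eqP->//|]; rewrite ltnS => /IH/le_trans; apply.
rewrite /= lerDl divr_ge0 ?(ltW a0) //.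
by rewrite ltW // ltr_wpDl // mulr_ge0 // gap_sum_ge0.
Qed.

(** The weight is 0 at index 0 and, through [minn], at index [K.+1]: both stand for the bikes in
    transit, whose deviation is controlled separately by [hub_bound]. *)
Definition weight {R : realFieldType} (B a : R) (K j : nat) : R :=
  if j is i.+1 then gap_sum B a K - gap_sum B a (minn i K) else 0.

Lemma weight_bounds {R : realFieldType} (B a : R) (K j : nat) :
  0 <= B -> 0 < a -> 0 <= weight B a K j <= gap_sum B a K.
Proof.
move=> B0 a0; case: j => [|i] /=; first by rewrite lexx gap_sum_ge0.
by rewrite subr_ge0 gap_sum_le ?geq_minr //= lerBlDr lerDl gap_sum_ge0.
Qed.

(** Let [G = C - h i.+1]. A jump up from [i.+1] gains [(B * G + 1) / ab] and, at rate [ab],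
    outweighs the other jumps, which lose at most [G] each and have total rate at most [B]; the net
    coefficient of [|x i.+1|] is at most -1. The weights are built from the arrival rate [ab] of the
    reference point, so as to be the same for all states. The actual rate is [ab + xa], which costs
    one [C * |xa|] per level; the direct feeding by [xa] costs the other. *)
Lemma tail_bound {R : realFieldType} (K : nat) (x s g yb q : nat -> R)
    (ab xa l sg d : R) (h := weight (l + sg * g K) ab K)
    (C := gap_sum (l + sg * g K) ab K) :
  x 0%N = 0 -> x K.+1 = 0 -> s K.+1 = s 0%N ->
  0 < ab -> 0 <= ab + xa -> 0 <= l -> 0 <= sg ->
  (forall i, 0 <= g i) -> (forall i, (i < K)%N -> g i <= g i.+1) ->
  (forall i, 0 <= q i) -> \sum_(i < K) q i.+1 <= 1 ->
  (forall i, `|s i| <= 1) -> (forall i, `|x i| - s i * x i <= d) ->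
  (forall i, `|x i| <= 1) -> (forall i, (i < K)%N -> 0 <= yb i <= 1) ->
  \sum_(i < K) (h i.+1 * s i.+1) * net_flow K x g yb q xa (ab + xa) l sg i <=
  - \sum_(i < K) `|x i.+1| + K%:R * C * (2 * `|xa|)
  + K%:R * C * (ab + xa + (l + sg * g K)) * d.
Proof.
move=> x0 xK sK ab0 a0 l0 sg0 g0 gmono q0 q1 s1 xd x1 yb01.
have d0 : 0 <= d by have := xd 0%N; rewrite x0 normr0 mulr0 subr0.
have gK i : (i <= K)%N -> g i <= g K by exact: le_last.
set B := l + sg * g K in h C *.
have B0 : 0 <= B by rewrite addr_ge0 // mulr_ge0.
have hb i : 0 <= h i <= C by apply: weight_bounds.
have h0 i : 0 <= h i by case/andP: (hb i).
have hC i : h i <= C by case/andP: (hb i).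
have C0 : 0 <= C by apply: gap_sum_ge0.
have hK : h K.+1 = h 0%N by rewrite /h /= minnn subrr.
have := @flow_bound R K x s h g yb q xa (ab + xa) l sg d x0 xK sK hK
  a0 l0 sg0 g0 gmono q0 q1 h0 s1 xd.
have h00 : h 0%N = 0 by [].
rewrite (eq_bigr (fun i : 'I_K => h i.+1 * s i.+1 *
    net_flow K x g yb q xa (ab + xa) l sg i));
  last by move=> i _; rewrite h00 mul0r subr0.
move/le_trans; apply.
have E1 : xa * (\sum_(i < K) yb i * (h i.+1 * s i.+1 - h 0%N * s 0%N)) <=
    K%:R * C * `|xa|.
  rewrite mulr_sumr -mulrA -[K in K%:R]card_ord mulr_natl -sumr_const.
  apply: ler_sum => i _; rewrite h00 mul0r subr0 (le_trans (ler_norm _)) //.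
  rewrite normrM mulrC ler_wpM2r // !normrM (ger0_norm (h0 _)).
  have /andP[y0 y1] := yb01 i (ltn_ord i).
  rewrite (ger0_norm y0) -[C]mul1r ler_pM ?mulr_ge0 //.
  by rewrite -[C]mulr1 ler_pM.
have E2 : \sum_(i < K) (`|x i.+1| *
    ((ab + xa) * (h i.+2 - h i.+1) + (l + sg * g i) * (h i - h i.+1)
     + sg * (g i.+1 - g i) *
       (\sum_(k < K) q k.+1 * (h k.+1 - h 0%N) - (h i.+1 - h 0%N)))
   + (ab + xa + (l + sg * g i.+1)) * (h i.+1 * d)) <=
   - \sum_(i < K) `|x i.+1| + K%:R * C * `|xa|
   + K%:R * C * (ab + xa + B) * d.
  have sumc (r : R) : K%:R * r = \sum_(i < K) r.
    by rewrite sumr_const card_ord mulr_natl.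
  rewrite -sumrN -!(mulrA K%:R) !sumc.
  rewrite -!big_split; apply: ler_sum => i0 _; cbv beta.
  have := ltn_ord i0; move: (nat_of_ord i0) => i iK {i0}.
  rewrite h00 subr0.
  set Q := \sum_(k < K) _.
  have QC : Q <= C.
    have : Q <= \sum_(k < K) q k.+1 * C.
      by apply: ler_sum => k _; rewrite subr0 ler_wpM2l.
    by move/le_trans; apply; rewrite -mulr_suml ler_piMl.
  pose G := gap_sum B ab i.
  have G0 : 0 <= G by apply: gap_sum_ge0.
  have hi1 : h i.+1 = C - G by rewrite /h /= (minn_idPl (ltnW iK)).
  have hi2 : h i.+2 = C - gap_sum B ab i.+1 by rewrite /h /weight (minn_idPl iK).
  have gi1 : gap_sum B ab i.+1 = G + (B * G + 1) / ab by [].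
  have giC : gap_sum B ab i.+1 <= C by apply: gap_sum_le.
  have hi : h i <= C by [].
  have mbB : l + sg * g i.+1 <= B by rewrite lerD2l ler_wpM2l ?gK.
  have mb0 : 0 <= l + sg * g i by rewrite addr_ge0 // mulr_ge0.
  have dg : 0 <= sg * (g i.+1 - g i) by rewrite mulr_ge0 // subr_ge0 gmono.
  have F1 : (ab + xa) * (h i.+2 - h i.+1) <= - (B * G + 1) + C * `|xa|.
    rewrite hi1 hi2 gi1.
    have -> : (ab + xa) * (C - (G + (B * G + 1) / ab) - (C - G)) =
      - (B * G + 1) - xa * ((B * G + 1) / ab).
      by field; rewrite gt_eqF.
    rewrite lerD2l (le_trans (ler_norm _)) // normrN normrM mulrC ler_wpM2r //.
    rewrite ger0_norm; last by rewrite divr_ge0 ?ltW // ltr_wpDl // mulr_ge0.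
    by lra.
  have F2 : (l + sg * g i) * (h i - h i.+1) <= (l + sg * g i) * G.
    by apply: ler_wpM2l => //; rewrite hi1; lra.
  have F3 : sg * (g i.+1 - g i) * (Q - h i.+1) <= sg * (g i.+1 - g i) * G.
    by apply: ler_wpM2l => //; rewrite hi1; lra.
  have F4 : (l + sg * g i.+1) * G <= B * G by apply: ler_wpM2r.
  have F : (ab + xa) * (h i.+2 - h i.+1) + (l + sg * g i) * (h i - h i.+1) +
     sg * (g i.+1 - g i) * (Q - h i.+1) <= -1 + C * `|xa| by lra.
  have := ler_wpM2l (normr_ge0 (x i.+1)) F.
  have Cx : 0 <= C * `|xa| by rewrite mulr_ge0.
  have := ler_wpM2r Cx (x1 i.+1).
  have F5 : (ab + xa + (l + sg * g i.+1)) * (h i.+1 * d) <= C * (ab + xa + B) * d.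
    rewrite mulrA ler_wpM2r // mulrC; apply: ler_pM => //; last by rewrite lerD2l.
    by apply: addr_ge0 => //; apply: addr_ge0 => //; apply: mulr_ge0.
  move=> H1 H2.
  apply: (@le_trans _ _ (- `|x i.+1| + C * `|xa| + C * (ab + xa + B) * d)) => //.
  by lra.
by apply: le_trans (lerD E1 E2) _; lra.
Qed.

(** * Existence of the equilibrium *)

Lemma continuous_bigsum {R : realType} (n : nat) (f : nat -> R -> R) :
  (forall i, continuous (f i)) -> continuous (fun x => \sum_(i < n) f i x).
Proof.
move=> fc; elim: n => [|n IH] x.
  under eq_fun do rewrite big_ord0; exact: cvg_cst.
under eq_fun do rewrite big_ord_recr /=.
by apply: cvgD; [exact: IH | exact: fc].
Qed.

Lemma continuous_bigprod {R : realType} (n : nat) (f : nat -> R -> R) :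
  (forall i, continuous (f i)) -> continuous (fun x => \prod_(i < n) f i x).
Proof.
move=> fc; elim: n => [|n IH] x.
  under eq_fun do rewrite big_ord0; exact: cvg_cst.
under eq_fun do rewrite big_ord_recr /=.
by apply: cvgM; [exact: IH | exact: fc].
Qed.

(** The mean of the law proportional to [c i * a ^+ i] is non-decreasing in [a]. As in Chebyshev's
    sum inequality, exchanging [i] and [j] and averaging turns the difference into a sum of terms in
    which [i - j] and [b ^+ i * a ^+ j - a ^+ i * b ^+ j] have the same sign. *)
Lemma tilted_mean_le {R : realFieldType} (n : nat) (c : nat -> R) (a b : R) :
  (forall i, 0 <= c i) -> 0 <= a <= b ->
  (\sum_(i < n) i%:R * (c i * a ^+ i)) * (\sum_(j < n) c j * b ^+ j) <=
  (\sum_(i < n) i%:R * (c i * b ^+ i)) * (\sum_(j < n) c j * a ^+ j).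
Proof.
move=> c0 /andP[a0 ab]; rewrite -subr_ge0 !big_distrlr -sumrB /=.
under eq_bigr do rewrite -sumrB.
set F := fun i j : nat => i%:R * (c i * b ^+ i) * (c j * a ^+ j)
                          - i%:R * (c i * a ^+ i) * (c j * b ^+ j).
have -> : \sum_(i < n) \sum_(j < n) F i j = 
  2^-1 * \sum_(i < n) \sum_(j < n) (F i j + F j i).
  under [in RHS]eq_bigr do rewrite big_split.
  by rewrite big_split /= [X in _ * (_ + X)]exchange_big /=; lra.
rewrite mulr_ge0 // ?invr_ge0 //; apply: sumr_ge0 => i _; apply: sumr_ge0 => j _.
have E : F i j + F j i =
  c i * c j * ((i%:R - j%:R) * (b ^+ i * a ^+ j - a ^+ i * b ^+ j)).
  by rewrite /F; ring.
have b0 : 0 <= b by apply: le_trans ab.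
rewrite E; apply: mulr_ge0; first exact: mulr_ge0.
have main (u v : nat) : (u <= v)%N -> 0 <= b ^+ v * a ^+ u - a ^+ v * b ^+ u.
  move=> uv; rewrite -(subnK uv) !exprD.
  have -> : b ^+ (v - u) * b ^+ u * a ^+ u - a ^+ (v - u) * a ^+ u * b ^+ u
    = a ^+ u * b ^+ u * (b ^+ (v - u) - a ^+ (v - u)) by ring.
  by rewrite mulr_ge0 ?mulr_ge0 ?exprn_ge0 // subr_ge0 lerXn2r // nnegrE.
have [ij|/ltnW ji] := leqP i j.
  apply: mulr_le0; first by rewrite subr_le0 ler_nat.
  by have := main _ _ ij; lra.
by apply: mulr_ge0; [rewrite subr_ge0 ler_nat | exact: main].
Qed.

Section Existence.
Context {R : realType} (K : nat) (lambda p gamma : R) (g : nat -> R).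
Hypotheses (K0 : (0 < K)%N) (lambda0 : 0 < lambda) (p01 : 0 <= p <= 1).
Hypotheses (gamma0 : 0 < gamma) (g0 : forall i, 0 < g i.+1).
Hypotheses (g00 : 0 <= g 0%N) (gmono : forall i, g i <= g i.+1).
Hypotheses (pg : 0 < p \/ 0 < g 0%N) (hg : g 0%N = 0 -> p * lambda < gamma).

(** [y a G] is the product-form law of a birth-death chain with arrival rate [a] and departure rates
    [den G n / G]. With [G] moved to the numerator in [w], everything stays defined at [G = 0],
    which the search for [G] has to include when [g 0 = 0]. *)
Let den (G : R) (i : nat) : R := lambda * ((1 - p) * G + p * g i).
Let w (G : R) (n : nat) : R := \prod_(i < n) (G / den G i.+1).
Let Z (a G : R) : R := \sum_(n < K.+1) w G n * a ^+ n.
Let y (a G : R) (n : nat) : R := w G n * a ^+ n / Z a G.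
Let m (a G : R) : R := \sum_(n < K.+1) n%:R * y a G n.

Let g_ge_g0 i : g 0%N <= g i.
Proof. by elim: i => // i /le_trans; apply. Qed.

Let g_le_gK i : (i <= K)%N -> g i <= g K.
Proof. by apply: le_last. Qed.

Let den_gt0 G i : g 0%N <= G -> 0 < den G i.+1.
Proof.
move=> gG; rewrite mulr_gt0 //; have /andP[p0 p1] := p01.
have G0 : 0 <= G by apply: le_trans gG.
have q0 : 0 <= 1 - p by lra.
case: pg => [p_gt0|g_gt0].
  by rewrite ltr_wpDl ?mulr_ge0 // mulr_gt0.
have G_gt0 : 0 < G by apply: lt_le_trans gG.
have := mulr_ge0 p0 (ltW (g0 i)); have := mulr_ge0 q0 G0.
have [pp|pp] := ltP 0 p; last first.
  have -> : p = 0 by lra.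
  by rewrite subr0 !mul1r; lra.
by have := mulr_gt0 pp (g0 i); lra.
Qed.

Let w_ge0 G n : g 0%N <= G -> 0 <= w G n.
Proof.
move=> gG; apply: prodr_ge0 => i _; rewrite divr_ge0 ?(ltW (den_gt0 _ _ gG)) //.
exact: le_trans gG.
Qed.

Let Z_ge1 a G : 0 <= a -> g 0%N <= G -> 1 <= Z a G.
Proof.
move=> a0 gG; rewrite /Z big_ord_recl /w big_ord0 expr0 mulr1 lerDl.
by apply: sumr_ge0 => i _; rewrite mulr_ge0 ?w_ge0 ?exprn_ge0.
Qed.

Let y_ge0 a G n : 0 <= a -> g 0%N <= G -> 0 <= y a G n.
Proof.
move=> a0 gG; rewrite divr_ge0 ?mulr_ge0 ?w_ge0 ?exprn_ge0 //.
by apply: le_trans (Z_ge1 _ _ a0 gG).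
Qed.

Let y_sum a G : 0 <= a -> g 0%N <= G -> \sum_(n < K.+1) y a G n = 1.
Proof.
move=> a0 gG; rewrite -mulr_suml divff // gt_eqF //.
by apply: lt_le_trans (Z_ge1 _ _ a0 gG).
Qed.

Let y_step a G n : 0 <= a -> g 0%N <= G ->
  y a G n.+1 = a * G / den G n.+1 * y a G n.
Proof. by move=> a0 gG; rewrite /y /w big_ord_recr /= exprS; ring. Qed.

Let m_ge0 a G : 0 <= a -> g 0%N <= G -> 0 <= m a G.
Proof. by move=> a0 gG; apply: sumr_ge0 => i _; rewrite mulr_ge0 ?y_ge0. Qed.

Let m_le a b G : 0 <= a <= b -> g 0%N <= G -> m a G <= m b G.
Proof.
move=> /andP[a0 ab] gG; have b0 : 0 <= b by apply: le_trans ab.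
have Za := lt_le_trans ltr01 (Z_ge1 _ _ a0 gG).
have Zb := lt_le_trans ltr01 (Z_ge1 _ _ b0 gG).
have mE c : m c G = (\sum_(n < K.+1) n%:R * (w G n * c ^+ n)) / Z c G.
  by rewrite mulr_suml; apply: eq_bigr => i _; rewrite /y; ring.
rewrite !mE ler_pdivrMr // mulrAC ler_pdivlMr //.
by apply: tilted_mean_le; [move=> i; exact: w_ge0 | rewrite a0].
Qed.

Let y_continuous (A B : R -> R) n :
  continuous A -> continuous B -> (forall t, 0 <= A t) ->
  (forall t, g 0%N <= B t) -> continuous (fun t => y (A t) (B t) n).
Proof.
move=> Ac Bc A0 B0 t.
have denc i : continuous (fun t => den (B t) i).
  move=> u; apply: cvgM; first exact: cvg_cst.
  apply: cvgD; last exact: cvg_cst.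
  by apply: cvgM; [exact: cvg_cst | exact: Bc].
have wc k : continuous (fun t => w (B t) k).
  apply: (continuous_bigprod k (fun i t => B t / den (B t) i.+1)) => i u.
  apply: cvgM; first exact: Bc.
  by apply: cvgV; [rewrite gt_eqF ?den_gt0 | exact: denc].
have Ak k : continuous (fun t => A t ^+ k).
  elim: k => [|k IH] u; first by under eq_fun do rewrite expr0; exact: cvg_cst.
  by under eq_fun do rewrite exprS; apply: cvgM; [exact: Ac | exact: IH].
have wAc k : continuous (fun t => w (B t) k * A t ^+ k).
  by move=> u; apply: cvgM; [exact: wc | exact: Ak].
apply: cvgM; first exact: wAc.
apply: cvgV; first by rewrite gt_eqF // (lt_le_trans ltr01) // Z_ge1.
exact: (continuous_bigsum K.+1 (fun k t => w (B t) k * A t ^+ k)).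
Qed.

Let m_continuous (A B : R -> R) :
  continuous A -> continuous B -> (forall t, 0 <= A t) ->
  (forall t, g 0%N <= B t) -> continuous (fun t => m (A t) (B t)).
Proof.
move=> Ac Bc A0 B0.
apply: (continuous_bigsum K.+1 (fun n t => n%:R * y (A t) (B t) n)) => n t.
by apply: cvgM; [exact: cvg_cst | exact: y_continuous].
Qed.

Let solve_arrival G : g 0%N <= G ->
  exists a, 0 <= a <= gamma /\ a + m a G = gamma.
Proof.
move=> gG.
have fc : continuous (fun a : R => a + m `|a| G).
  move=> a; apply: cvgD; first exact: cvg_id.
  apply: (m_continuous (fun a => `|a|) (fun=> G)) => //.
    exact: norm_continuous.
  exact: cst_continuous.
have m0 : m 0 G = 0.
  rewrite /m big1 // => -[[|n] ?] _; first by rewrite mul0r.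
  by rewrite /y /= expr0n /= mulr0 mul0r mulr0.
have mg : 0 <= m gamma G by apply: m_ge0 => //; apply: ltW.
have [||a] := @IVT R (fun a => a + m `|a| G) 0 gamma gamma (ltW gamma0).
- exact: continuous_subspaceT.
- rewrite normr0 m0 addr0 gtr0_norm //.
  by rewrite ge_min (ltW gamma0) le_max lerDl mg orbT.
rewrite in_itv /= => /andP[a0 ag]; rewrite ger0_norm // => E.
by exists a; rewrite a0 ag.
Qed.

Lemma mean_field_equilibrium_exists : exists (x : nat -> R) (a G : R),
  [/\ forall n, (n <= K)%N -> 0 < x n, \sum_(n < K.+1) x n = 1,
      G = \sum_(n < K.+1) x n * g n, a = gamma - \sum_(n < K.+1) n%:R * x n
    & [/\ 0 < a, 0 < G & forall n, (n < K)%N ->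
      a * x n = lambda * ((1 - p) + p * (g n.+1 / G)) * x n.+1]].
Proof.
(* Parametrising the admissible mean weights by the whole line makes all the functions below
   continuous everywhere, without a domain condition. *)
pose B (t : R) : R := g 0%N + `|t|.
have B0 t : g 0%N <= B t by rewrite lerDl.
have Bc : continuous B.
  by move=> t; apply: cvgD; [exact: cvg_cst | exact: norm_continuous].
have /choice[A AP] t := solve_arrival (B t) (B0 t).
have A0 t : 0 <= A t by have [/andP[]] := AP t.
(* As [m] is non-decreasing in its first argument, [a + m a G] increases at least as fast as [a]. So
   [A] varies by no more than [m (A t)] does when only the mean weight changes. *)
have Ac : continuous A.
  move=> t; apply/cvgrPdist_le => e e0.
  have := m_continuous (fun=> A t) B (@cst_continuous _ _ _) Bc (fun=> A0 t) B0 t.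
  move=> /cvgrPdist_le/(_ e e0); apply: filterS => s /= H.
  apply: le_trans H.
  have [_ Es] := AP s; have [_ Et] := AP t.
  have [sa|sa] := lerP (A s) (A t).
    have := @m_le (A s) (A t) (B s); rewrite A0 sa => /(_ isT (B0 s)) h.
    by rewrite ler_normr; apply/orP; right; lra.
  have := @m_le (A t) (A s) (B s); rewrite A0 (ltW sa) => /(_ isT (B0 s)) h.
  by rewrite ler_normr; apply/orP; left; lra.
(* [Psi t] is the mean of [g] divided by [B t], with [y n.+1 / B t] rewritten through [y_step] so as
   to make sense at [B t = 0]. If [g 0 = 0], the equation equating the mean of [g] with [G] has the
   spurious root [G = 0], where all stations are empty; the equation [Psi t = 1] excludes it, since
   there [Psi] equals [gamma / (p * lambda)], which exceeds 1 by [hg]. *)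
pose Psi (t : R) : R := \sum_(n < K) g n.+1 * (A t / den (B t) n.+1 * y (A t) (B t) n)
              + g 0%N * y (A t) (B t) 0%N / B t.
have Psic : continuous Psi.
  move=> t; apply: cvgD.
    apply: (continuous_bigsum K (fun n t =>
      g n.+1 * (A t / den (B t) n.+1 * y (A t) (B t) n))) => n u.
    apply: cvgM; first exact: cvg_cst.
    apply: cvgM; last exact: (y_continuous A B).
    apply: cvgM; first exact: Ac.
    apply: cvgV; first by rewrite gt_eqF ?den_gt0.
    apply: cvgM; first exact: cvg_cst.
    apply: cvgD; last exact: cvg_cst.
    by apply: cvgM; [exact: cvg_cst | exact: Bc].
  have [gz|gz] := eqVneq (g 0%N) 0.
    by rewrite gz !mul0r; under eq_fun do rewrite !mul0r; exact: cvg_cst.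
  apply: cvgM; first by apply: cvgM; [exact: cvg_cst | exact: (y_continuous A B)].
  apply: cvgV; last exact: Bc.
  by rewrite gt_eqF // (lt_le_trans _ (B0 t)) // lt_neqAle eq_sym gz.
have PsiE t : 0 < B t ->
  B t * Psi t = \sum_(n < K.+1) y (A t) (B t) n * g n.
  move=> Bt; rewrite /Psi mulrDr big_ord_recl addrC mulr_sumr; congr (_ + _).
    by rewrite mulrCA divff ?gt_eqF // mulr1 mulrC.
  by apply: eq_bigr => n _ /=; rewrite y_step //; ring.
have Bpos : g 0%N = 0 \/ 0 < g 0%N.
  by move: g00; rewrite le_eqVlt eq_sym => /orP[/eqP|]; [left|right].
have gK : 0 < g K by rewrite -(prednK K0).
have B00 : B 0 = g 0%N by rewrite /B normr0 addr0.
have A_0 : g 0%N = 0 -> forall n, y (A 0) (B 0) n.+1 = 0.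
  by move=> gz n; rewrite y_step // B00 gz mulr0 !mul0r.
have A_gamma : g 0%N = 0 -> y (A 0) (B 0) 0%N = 1 /\ A 0 = gamma.
  move=> gz; split.
    have := y_sum _ _ (A0 0) (B0 0); rewrite big_ord_recl big1 ?addr0 //.
    by move=> n _ /=; apply: A_0.
  have [_ <-] := AP 0; rewrite /m big_ord_recl big1 ?mul0r ?addr0 //.
  by move=> n _ /=; rewrite A_0 // mulr0.
have Psi0z : g 0%N = 0 -> 1 < Psi 0.
  move=> gz; have [y0 Ag] := A_gamma gz.
  rewrite /Psi gz !mul0r addr0 -(prednK K0) big_ord_recl /= big1 ?addr0; last first.
    by move=> n _ /=; rewrite A_0 // !mulr0.
  have p_gt0 : 0 < p by case: pg => //; rewrite gz ltxx.
  rewrite y0 Ag /den B00 gz mulr0 add0r mulr1.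
  have -> : g 1%N * (gamma / (lambda * (p * g 1%N))) = gamma / (p * lambda).
    by field; rewrite !gt_eqF.
  by rewrite ltr_pdivlMr ?mulr_gt0 // mul1r; exact: hg.
have Psi0 : 1 <= Psi 0.
  case: Bpos => [/Psi0z/ltW//|g_gt0].
  have B_gt0 : 0 < B 0 by rewrite B00.
  rewrite -(ler_pM2l B_gt0) mulr1 PsiE // -[leLHS]mulr1 -(y_sum _ _ (A0 0) (B0 0)).
  rewrite mulr_sumr; apply: ler_sum => n _; rewrite mulrC ler_wpM2l ?y_ge0 //.
  by rewrite B00.
have gK0 : 0 <= g K - g 0%N by rewrite subr_ge0.
have BK : B (g K - g 0%N) = g K by rewrite /B ger0_norm // addrC subrK.
have PsiK : Psi (g K - g 0%N) <= 1.
  have B_gt0 : 0 < B (g K - g 0%N) by rewrite BK.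
  rewrite -(ler_pM2l B_gt0) mulr1 PsiE // -[leRHS]mulr1.
  rewrite -(y_sum _ _ (A0 (g K - g 0%N)) (B0 (g K - g 0%N))) mulr_sumr.
  apply: ler_sum => n _; rewrite [leRHS]mulrC ler_wpM2l ?y_ge0 // BK g_le_gK //.
  by rewrite -ltnS.
have [||t _ Psit] := @IVT R Psi 0 (g K - g 0%N) 1 gK0.
- exact: continuous_subspaceT.
- by rewrite ge_min le_max Psi0 PsiK orbT.
have B_gt0 : 0 < B t.
  have: 0 <= B t by apply: le_trans (B0 t).
  rewrite le_eqVlt eq_sym => /orP[/eqP Bt|//].
  have gz : g 0%N = 0 by have := B0 t; rewrite Bt => h; have := g00; lra.
  have tz : t = 0.
    by move: Bt; rewrite /B gz add0r => /eqP; rewrite normr_eq0 => /eqP.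
  by have := Psi0z gz; rewrite -tz Psit ltxx.
have [_ Et] := AP t.
have A_gt0 : 0 < A t.
  have := A0 t; rewrite le_eqVlt eq_sym => /orP[/eqP At|//].
  move: Et; rewrite At add0r /m big_ord_recl mul0r add0r big1 => [E|n _ /=].
    by move: gamma0; rewrite -E ltxx.
  by rewrite y_step // mul0r mul0r mul0r mulr0.
exists (y (A t) (B t)), (A t), (B t); split.
- move=> n _; rewrite divr_gt0 ?mulr_gt0 ?exprn_gt0 //.
    by apply: prodr_gt0 => i _; rewrite divr_gt0 ?den_gt0.
  by rewrite (lt_le_trans ltr01) ?Z_ge1.
- exact: y_sum.
- by rewrite -PsiE // Psit mulr1.
- by rewrite -/(m _ _); lra.
- split=> // n nK; rewrite y_step //.
  have := den_gt0 (B t) n (B0 t); rewrite /den => d0.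
  by field; rewrite !gt_eqF // -(pmulr_rgt0 _ lambda0).
Qed.

End Existence.

(** * Tails and fluxes *)

Definition tail {R : realType} {K : nat} (y : 'rV[R]_K.+1) (k : nat) : R :=
  \sum_(n < K.+1 | (k <= n)%N) y 0 n.

Section Tails.
Context {R : realType} {K : nat}.
Implicit Types (y z : 'rV[R]_K.+1).

Lemma tailD y z k : tail (y + z) k = tail y k + tail z k.
Proof. by rewrite /tail -big_split; apply: eq_bigr => i _; rewrite mxE. Qed.

Lemma tailZ (a : R) y k : tail (a *: y) k = a * tail y k.
Proof. by rewrite /tail mulr_sumr; apply: eq_bigr => i _; rewrite mxE. Qed.

Lemma tail_sum (I : finType) (F : I -> 'rV[R]_K.+1) k :
  tail (\sum_i F i) k = \sum_i tail (F i) k.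
Proof.
rewrite exchange_big; apply: eq_bigr => n _ /=.
by rewrite summxE.
Qed.

Lemma tail_delta (m : 'I_K.+1) k : tail (delta_mx 0 m) k = (k <= m)%N%:R :> R.
Proof.
rewrite /tail; have [km|mk] := leqP k m.
  rewrite (bigD1 m) //= mxE !eqxx big1 ?addr0 // => i /andP[_ im].
  by rewrite mxE (negbTE im) andbF.
rewrite big1 // => i ki; rewrite mxE /=.
by case: eqP => // im; move: mk; rewrite -im ltnNge ki.
Qed.

Lemma tail_step_down (n : 'I_K.+1) k : (0 < n)%N ->
  tail (step_down R n) k = - (k == n)%:R.
Proof.
move=> n0; rewrite /step_down -scaleN1r tailD tailZ !tail_delta.
rewrite inordK ?(leq_ltn_trans (leq_pred _)) // mulN1r.
case: n n0 => [[|n] nK] //= _.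
case: (ltngtP k n.+1) => h.
- by move: (h); rewrite ltnS => ->; rewrite subrr oppr0.
- by rewrite leqNgt (ltnW h) subrr oppr0.
- by rewrite h ltnn sub0r.
Qed.

Lemma tail_step_up (n : 'I_K.+1) k : (n < K)%N ->
  tail (step_up R n) k = (k == n.+1)%:R.
Proof.
move=> nK; rewrite /step_up -scaleN1r tailD tailZ !tail_delta inordK // mulN1r.
case: (ltngtP k n.+1) => h.
- by rewrite -ltnS h subrr.
- by rewrite leqNgt (ltnW h) subrr.
- by rewrite h ltnn subr0.
Qed.

Lemma tail0 y : tail y 0 = \sum_n y 0 n. Proof. by []. Qed.

Lemma tail_over y k : (K < k)%N -> tail y k = 0.
Proof.
move=> Kk; rewrite /tail big1 // => i ki.
by have := leq_trans Kk (leq_trans ki (leq_ord i)); rewrite ltnn.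
Qed.

Lemma tail_pred y n : (n <= K)%N -> y 0 (inord n) = tail y n - tail y n.+1.
Proof.
move=> nK; rewrite [tail y n](bigD1 (inord n)) ?inordK //=.
rewrite [X in _ + X - _](_ : _ = tail y n.+1) ?addrK //.
apply: eq_bigl => i; rewrite -val_eqE /= inordK // [RHS]ltn_neqAle.
by rewrite andbC eq_sym.
Qed.

Lemma tail_succ_sum y : \sum_(j < K.+1) j%:R * y 0 j = \sum_(i < K) tail y i.+1.
Proof.
rewrite (exchange_big_dep xpredT) //=; apply: eq_bigr => j _.
under [RHS]eq_bigr do rewrite -[y 0 j]mul1r.
rewrite -mulr_suml; congr (_ * _).
have -> : j%:R = \sum_(0 <= i < j) (1 : R) by rewrite sumr_const_nat subn0.
by rewrite (big_nat_widen _ _ K) ?leq_ord // big_mkord.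
Qed.

Lemma tail_weighted_sum y (g : nat -> R) : \sum_n y 0 n = 1 ->
  \sum_n y 0 n * g n = g 0%N + \sum_(i < K) (g i.+1 - g i) * tail y i.+1.
Proof.
move=> y1; rewrite -[g 0%N]mulr1 -y1.
rewrite mulr_sumr [X in _ + X](_ : _ = \sum_n y 0 n * (g n - g 0%N)).
  by rewrite -big_split; apply: eq_bigr => n _; rewrite /=; ring.
under eq_bigr do rewrite mulr_sumr.
rewrite (exchange_big_dep xpredT) //=; apply: eq_bigr => j _.
rewrite -mulr_suml mulrC; congr (_ * _).
rewrite -(telescope_sumr _ (leq0n j)) (big_nat_widen _ _ K) ?leq_ord //=.
by rewrite big_mkord.
Qed.

Lemma vec_eq0 y : (forall k, tail y k = 0) -> y = 0.
Proof.
move=> y0; apply/rowP => n; rewrite mxE -[n]inord_val tail_pred ?leq_ord //.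
by rewrite !y0 subrr.
Qed.

Lemma arrivalE (m : R) y : arrival m y = m - \sum_(i < K) tail y i.+1.
Proof. by rewrite /arrival tail_succ_sum. Qed.

End Tails.

Section Flows.
Context {R : realType} {K : nat} (lambda p : R) (g : 'I_K.+1 -> R).

Definition flux (m : R) (y : 'rV[R]_K.+1) (i : nat) : R :=
  arrival m y * y 0 (inord i)
  - departure lambda p g y (inord i.+1) * y 0 (inord i.+1).

Lemma tail_drift (m : R) (y : 'rV[R]_K.+1) (k : nat) :
  tail (drift lambda p m g y) k.+1 = if (k < K)%N then flux m y k else 0.
Proof.
rewrite tail_sum.
have E (n : 'I_K.+1) : tail (y 0 n *:
    ((departure lambda p g y n * (0 < n)%N%:R) *: step_down R n +
     (arrival m y * (n < K)%N%:R) *: step_up R n)) k.+1 =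
    (if n == k.+1 :> nat then - (departure lambda p g y n * y 0 n) else 0) +
    (if (n == k :> nat) && (k < K)%N then arrival m y * y 0 n else 0).
  rewrite tailZ tailD !tailZ mulrDr; congr (_ + _).
    have [n0|] := posnP n; first by rewrite n0 !(mulr0, mul0r).
    move=> n0; rewrite tail_step_down // mulr1 eq_sym.
    by case: eqP => _; rewrite ?mulrN1 ?oppr0 ?mulr0 // mulrN mulrC.
  have [nK|nK] := ltnP n K; last first.
    rewrite !(mulr0, mul0r); case: eqP => //= nk.
    by rewrite -nk ltnNge nK.
  rewrite tail_step_up // eqSS mulr1 eq_sym.
  case: eqP => [nk|_] /=; last by rewrite !mulr0.
  by rewrite -nk nK mulr1 mulrC.
under eq_bigr do rewrite E.
rewrite big_split -!big_mkcond /=.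
case: ifP => kK; last first.
  rewrite big1; last first.
    move=> n /eqP nk; have := ltn_ord n; rewrite nk ltnS => k1.
    by rewrite k1 in kK.
  by rewrite big_pred0 ?addr0 // => n; rewrite andbF.
rewrite (big_pred1 (inord k.+1)) => [|n]; last first.
  by rewrite /= -[RHS](inj_eq val_inj) /= inordK.
rewrite (big_pred1 (inord k)) => [|n]; last first.
  by rewrite /= andbT -[RHS](inj_eq val_inj) /= inordK // ltnS ltnW.
by rewrite /flux addrC.
Qed.

Lemma tail_drift0 (m : R) (y : 'rV[R]_K.+1) : tail (drift lambda p m g y) 0 = 0.
Proof.
rewrite tail_sum big1 // => n _; rewrite tailZ tailD !tailZ.
have D : (0 < n)%N%:R * tail (step_down R n) 0 = 0.
  have [_|n0] := posnP n; first by rewrite mul0r.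
  by rewrite tail_step_down // ltn_eqF // oppr0 mulr0.
have U : (n < K)%N%:R * tail (step_up R n) 0 = 0.
  by have [nK|_] := ltnP n K; rewrite ?mul0r // tail_step_up // mulr0.
by rewrite -!mulrA D U !mulr0 addr0 mulr0.
Qed.

Lemma drift_eq0 (m : R) (y : 'rV[R]_K.+1) :
  drift lambda p m g y = 0 <-> forall k, (k < K)%N -> flux m y k = 0.
Proof.
split=> [b0 k kK|J0].
  have := tail_drift m y k; rewrite b0 kK => <-.
  by rewrite /tail big1 // => i _; rewrite mxE.
apply: vec_eq0 => -[|k]; first exact: tail_drift0.
by rewrite tail_drift; case: ifP => // /J0.
Qed.

End Flows.

(** * Decrease of the two distances along the mean field, and uniqueness of the equilibrium *)

Section Estimates.
Context {R : realType} {K : nat} (lambda p : R) (g : 'I_K.+1 -> R).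
Hypotheses (K0 : (0 < K)%N) (lambda0 : 0 < lambda) (p01 : 0 <= p <= 1).
Hypothesis gmono : forall m n : 'I_K.+1, (m <= n)%N -> g m <= g n.
Hypothesis g0 : forall n : 'I_K.+1, 0 <= g n.
Hypothesis g_gt0 : forall n : 'I_K.+1, (0 < n)%N -> 0 < g n.

Let gn n := g (inord (minn n K)).

Let gnE (n : 'I_K.+1) : gn n = g n.
Proof. by rewrite /gn (minn_idPl (leq_ord n)) inord_val. Qed.

Let gn_mono i : gn i <= gn i.+1.
Proof.
apply: gmono; rewrite !inordK ?ltnS ?geq_minr //.
by rewrite leq_min geq_minr andbT geq_min leqnSn.
Qed.

Lemma tail_ge0 (y : 'rV[R]_K.+1) k : is_prob_vec y -> 0 <= tail y k.
Proof. by move=> [y0 _]; apply: sumr_ge0. Qed.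

Lemma tail_le1 (y : 'rV[R]_K.+1) k : is_prob_vec y -> tail y k <= 1.
Proof.
move=> [y0 <-]; rewrite /tail big_mkcond /=; apply: ler_sum => i _.
by case: ifP.
Qed.

Lemma arrival_le (m : R) (y : 'rV[R]_K.+1) : is_prob_vec y -> arrival m y <= m.
Proof. by move=> yP; rewrite arrivalE gerBl sumr_ge0 // => i _; exact: tail_ge0. Qed.

Lemma prob_vec_le1 (y : 'rV[R]_K.+1) n : is_prob_vec y -> y 0 n <= 1.
Proof. by move=> [y0 <-]; rewrite (bigD1 n) //= lerDl sumr_ge0. Qed.

Lemma service_share_le1 (y : 'rV[R]_K.+1) (G := \sum_j y 0 j * g j) :
  is_prob_vec y -> \sum_(i < K) g (inord i.+1) * y 0 (inord i.+1) / G <= 1.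
Proof.
move=> [y0 _]; have G0 : 0 <= G by apply: sumr_ge0 => j _; rewrite mulr_ge0.
rewrite -mulr_suml; have [->|Gn0] := eqVneq G 0; first by rewrite invr0 mulr0.
rewrite ler_pdivrMr ?lt_neqAle 1?eq_sym ?Gn0 // mul1r /G big_ord_recl /=.
apply: (@le_trans _ _ (\sum_(i < K) y 0 (lift ord0 i) * g (lift ord0 i))).
  by apply: ler_sum => i _; rewrite mulrC -[lift ord0 i]inord_val.
by rewrite lerDr mulr_ge0.
Qed.

(* Splitting the difference of the services with the mean weight [Gb] of the
   reference point [yb] in the denominators keeps all coefficients bounded
   even when that of [y] is small. *)
Lemma flux_net_flow (m gamma : R) (y yb : 'rV[R]_K.+1)
    (G := \sum_j y 0 j * g j) (Gb := \sum_j yb 0 j * g j) (i : nat) :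
  is_prob_vec y -> is_prob_vec yb -> 0 < Gb -> (i < K)%N ->
  flux lambda p g gamma yb i = 0 ->
  flux lambda p g m y i =
  net_flow K (fun k => tail y k - tail yb k) gn (fun n => yb 0 (inord n))
    (fun n => gn n * y 0 (inord n) / G) (arrival m y - arrival gamma yb)
    (arrival m y) (lambda * (1 - p)) (lambda * p / Gb) i.
Proof.
move=> yP ybP Gb0 iK; rewrite /flux /net_flow.
have y0 := yP.1; have y1 := yP.2; have yb1 := ybP.2.
have -> : \sum_(j < K) (gn j.+1 - gn j) * (tail y j.+1 - tail yb j.+1) = G - Gb.
  have E z : is_prob_vec z -> \sum_j z 0 j * g j =
      gn 0 + \sum_(j < K) (gn j.+1 - gn j) * tail z j.+1.
    move=> [_ z1]; rewrite -tail_weighted_sum //.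
    by apply: eq_bigr => j _; rewrite gnE.
  rewrite /G /Gb !E // opprD addrACA subrr add0r -sumrB.
  by apply: eq_bigr => j _; rewrite mulrBr.
have diff (z w : 'rV[R]_K.+1) n : (n <= K)%N ->
    tail z n - tail w n - (tail z n.+1 - tail w n.+1) =
    z 0 (inord n) - w 0 (inord n) :> R.
  move=> nK; rewrite !tail_pred //.
  by move: (tail z n) (tail w n) (tail z n.+1) (tail w n.+1) => ? ? ? ?; ring.
rewrite !diff ?(ltnW iK) // /departure -/G -/Gb.
have gi : gn i.+1 = g (inord i.+1) by rewrite /gn (minn_idPl iK).
rewrite gi.
set a := arrival m y; set ab := arrival gamma yb.
set gi1 := g (inord i.+1); set yi1 := y 0 (inord i.+1).
(* If [G = 0], the quotients by [G] are 0 by convention, and each product [g n * y n] is 0 as well,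
   so the identity survives. *)
have [Gz|Gn0] := eqVneq G 0.
  have gy : gi1 * yi1 = 0.
    have := Gz; move/eqP; rewrite psumr_eq0 => [/allP /(_ (inord i.+1))|j _].
      by rewrite mem_index_enum => /(_ isT) /eqP; rewrite mulrC.
    by rewrite mulr_ge0.
  rewrite Gz invr0 !mulr0 addr0 => Eb.
  have gy' : lambda * p / Gb * (gi1 * yi1) = 0 by rewrite gy mulr0.
  by lra.
move=> Eb.
have -> : a * y 0 (inord i) - lambda * (1 - p + p * (gi1 / G)) * yi1 =
   (a * y 0 (inord i) - lambda * (1 - p + p * (gi1 / G)) * yi1) -
   (ab * yb 0 (inord i) - lambda * (1 - p + p * (gi1 / Gb)) * yb 0 (inord i.+1)).
  by rewrite Eb subr0.
by field; rewrite Gn0 gt_eqF.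
Qed.

Section Reference.
Context (gamma : R) (yb : 'rV[R]_K.+1).
Hypotheses (ybP : is_prob_vec yb) (yb_gt0 : forall n, 0 < yb 0 n).
Hypotheses (ab_gt0 : 0 < arrival gamma yb).
Hypotheses (fluxb : forall i, (i < K)%N -> flux lambda p g gamma yb i = 0).

Let Gb := \sum_j yb 0 j * g j.

Let Gb_gt0 : 0 < Gb.
Proof.
rewrite /Gb (bigD1 ord_max) //=; apply: ltr_wpDr.
  by apply: sumr_ge0 => j _; rewrite mulr_ge0 // ltW.
by rewrite mulr_gt0 // g_gt0.
Qed.

(* Satisfied by the sign function for [d = 0] and by [slope d] for [d > 0]. *)
Definition near_sign (d : R) (s : R -> R) : Prop :=
  forall r, [/\ `|s r| <= 1, `|r| - s r * r <= d,
    r <= 0 -> s r <= 0 & 0 <= r -> 0 <= s r].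

Let sg_ge0 : 0 <= lambda * p / Gb.
Proof.
by have /andP[p0 _] := p01; rewrite divr_ge0 ?(ltW Gb_gt0) // mulr_ge0 // ltW.
Qed.

Let l_ge0 : 0 <= lambda * (1 - p).
Proof. by have /andP[_ p1] := p01; rewrite mulr_ge0 ?subr_ge0 // ltW. Qed.

Let x (y : 'rV[R]_K.+1) k := tail y k - tail yb k.

Let x0 y : is_prob_vec y -> x y 0 = 0.
Proof. by move=> [_ y1]; rewrite /x !tail0 y1 ybP.2 subrr. Qed.

Let xK y : x y K.+1 = 0.
Proof. by rewrite /x !tail_over // subrr. Qed.

Let sumq y : is_prob_vec y ->
  \sum_(i < K) gn i.+1 * y 0 (inord i.+1) / (\sum_j y 0 j * g j) <= 1.
Proof.
move=> yP; apply: le_trans (service_share_le1 y yP).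
by apply: ler_sum => i _; rewrite /gn (minn_idPl (ltn_ord i)).
Qed.

Let q_ge0 (y : 'rV[R]_K.+1) n : is_prob_vec y ->
  0 <= gn n * y 0 (inord n) / (\sum_j y 0 j * g j).
Proof.
move=> [y0 _]; rewrite divr_ge0 ?mulr_ge0 ?g0 //.
by apply: sumr_ge0 => j _; rewrite mulr_ge0.
Qed.

Lemma hub_estimate (Gam : R) : exists c C : R, [/\ 0 < c, 0 <= C &
  forall (m d : R) (y : 'rV[R]_K.+1) (s : R -> R), is_prob_vec y ->
    0 <= arrival m y -> m <= Gam -> 0 <= d -> near_sign d s ->
    \sum_(i < K) (s (tail y i.+1 - tail yb i.+1)
                  - s (arrival m y - arrival gamma yb)) * flux lambda p g m y i
    <= - c * `|arrival m y - arrival gamma yb| + C * (d + `|m - gamma|)].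
Proof.
(* A product of numbers in [(0, 1]] lies below each factor, which gives a positive lower bound for
   all levels at once. *)
pose c := \prod_n yb 0 n.
have cyb n : c <= yb 0 n.
  rewrite /c (bigD1 n) //= ler_piMr ?(ltW (yb_gt0 _)) //.
  by apply: prodr_ile1 => j _; rewrite ltW //= prob_vec_le1.
have c_gt0 : 0 < c by apply: prodr_gt0.
pose B := lambda * (1 - p) + lambda * p / Gb * gn K.
have B0 : 0 <= B by rewrite addr_ge0 // mulr_ge0 ?g0.
have D0 : 0 <= K%:R * (1 + `|Gam| + B).
  by apply: mulr_ge0 => //; apply: addr_ge0 => //; apply: addr_ge0.
exists c, (c + K%:R * (1 + `|Gam| + B)); split=> //.
  by apply: addr_ge0 => //; apply: ltW.
move=> m d y s yP a0 mG d0 sP.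
set xa := arrival m y - arrival gamma yb.
(* At the indices 0 and [K.+1] the tail deviation is 0; there the sign is replaced by that of the
   bikes in transit. *)
pose s' k := if (k == 0) || (k == K.+1) then s xa else s (x y k).
have s'E i : (i < K)%N -> s' i.+1 = s (x y i.+1).
  by move=> iK; rewrite /s' eqSS (ltn_eqF iK).
have := @hub_bound R K (x y) s' gn (fun n => yb 0 (inord n))
  (fun n => gn n * y 0 (inord n) / (\sum_j y 0 j * g j)) xa (arrival m y)
  (lambda * (1 - p)) (lambda * p / Gb) d c (m - gamma)
  (x0 y yP) (xK y) _ a0 l_ge0 sg_ge0 (fun=> g0 _) (fun i _ => gn_mono i)
  (fun n => q_ge0 y n yP) (sumq y yP).
have E0 : s' K.+1 = s' 0%N by rewrite /s' eqxx orbT.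
move/(_ E0) => H.
rewrite (eq_bigr (fun i : 'I_K => (s' i.+1 - s' 0%N) *
  net_flow K (x y) gn (fun n => yb 0 (inord n))
  (fun n => gn n * y 0 (inord n) / (\sum_j y 0 j * g j)) xa (arrival m y)
  (lambda * (1 - p)) (lambda * p / Gb) i)); last first.
  by move=> i _; rewrite s'E // (flux_net_flow m gamma y yb i) ?fluxb.
apply: le_trans (H _ _ _ _ _ (ltW c_gt0) _ _) _.
- by move=> i; rewrite /s'; case: ifP => _; [case: (sP xa) | case: (sP (x y i))].
- move=> i; rewrite /s'; case: ifP => [|_]; last by case: (sP (x y i)).
  by case/orP => /eqP ->; rewrite ?x0 ?xK // normr0 mulr0 subr0.
- by case: (sP xa).
- by move=> i iK; rewrite s'E //; case: (sP (x y i.+1)).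
- by move=> i iK; rewrite s'E //; case: (sP (x y i.+1)).
- by move=> i iK; rewrite cyb prob_vec_le1.
- rewrite /xa !arrivalE /x sumrB; ring.
have Ka : K%:R * (1 + arrival m y + B) * d <= K%:R * (1 + `|Gam| + B) * d.
  rewrite ler_wpM2r // ler_wpM2l // lerD2r lerD2l.
  by rewrite (le_trans (arrival_le _ _ yP)) // (le_trans mG) // ler_norm.
have := mulr_ge0 (ltW c_gt0) d0; have := mulr_ge0 D0 (normr_ge0 (m - gamma)).
rewrite -/B; lra.
Qed.

Lemma tail_estimate (Gam : R) : exists (h : nat -> R) (C : R),
  [/\ 0 <= C, h 0%N = 0, forall i, 0 <= h i <= C &
  forall (m d : R) (y : 'rV[R]_K.+1) (s : R -> R), is_prob_vec y ->
    0 <= arrival m y -> m <= Gam -> 0 <= d -> near_sign d s ->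
    \sum_(i < K) (h i.+1 * s (tail y i.+1 - tail yb i.+1)) * flux lambda p g m y i
    <= - \sum_(i < K) `|tail y i.+1 - tail yb i.+1|
       + C * (`|arrival m y - arrival gamma yb| + d)].
Proof.
pose B := lambda * (1 - p) + lambda * p / Gb * gn K.
have B0 : 0 <= B by rewrite addr_ge0 // mulr_ge0 ?g0.
pose H := gap_sum B (arrival gamma yb) K.
have H0 : 0 <= H by apply: gap_sum_ge0.
(* The 2 absorbs the factor of [|xa|] in [tail_bound]; [|Gam| + B] bounds the total rate that
   multiplies [d] there. *)
pose D := 2 + `|Gam| + B.
have D1 : 1 <= D by rewrite /D; have := normr_ge0 Gam; lra.
have D0 : 0 <= D by lra.
have KR : 1 <= K%:R :> R by rewrite ler1n.
exists (weight B (arrival gamma yb) K), (K%:R * H * D); split.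
- by apply: mulr_ge0 => //; apply: mulr_ge0.
- by [].
- move=> i; have /andP[-> h2] := weight_bounds B (arrival gamma yb) K i B0 ab_gt0.
  apply: le_trans h2 _; rewrite -/H mulrAC ler_peMl //.
  by apply: (le_trans KR); rewrite ler_peMr.
move=> m d y s yP a0 mG d0 sP.
set xa := arrival m y - arrival gamma yb.
have aE : arrival m y = arrival gamma yb + xa by rewrite /xa; ring.
pose s' k := if (k == 0) || (k == K.+1) then s xa else s (x y k).
have s'E i : (i < K)%N -> s' i.+1 = s (x y i.+1).
  by move=> iK; rewrite /s' eqSS (ltn_eqF iK).
have E0 : s' K.+1 = s' 0%N by rewrite /s' eqxx orbT.
have a0' : 0 <= arrival gamma yb + xa by rewrite -aE.
have := @tail_bound R K (x y) s' gn (fun n => yb 0 (inord n))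
  (fun n => gn n * y 0 (inord n) / (\sum_j y 0 j * g j)) (arrival gamma yb) xa
  (lambda * (1 - p)) (lambda * p / Gb) d
  (x0 y yP) (xK y) E0 ab_gt0 a0' l_ge0 sg_ge0 (fun=> g0 _) (fun i _ => gn_mono i)
  (fun n => q_ge0 y n yP) (sumq y yP).
rewrite -/B -/H -aE => F.
rewrite (eq_bigr (fun i : 'I_K => (weight B (arrival gamma yb) K i.+1 * s' i.+1) *
  net_flow K (x y) gn (fun n => yb 0 (inord n))
  (fun n => gn n * y 0 (inord n) / (\sum_j y 0 j * g j)) xa (arrival m y)
  (lambda * (1 - p)) (lambda * p / Gb) i)); last first.
  by move=> i _; rewrite s'E // (flux_net_flow m gamma y yb i) ?fluxb.
apply: le_trans (F _ _ _ _) _.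
- by move=> i; rewrite /s'; case: ifP => _; [case: (sP xa) | case: (sP (x y i))].
- move=> i; rewrite /s'; case: ifP => [|_]; last by case: (sP (x y i)).
  by case/orP => /eqP ->; rewrite ?x0 ?xK // normr0 mulr0 subr0.
- move=> i; rewrite ler_norml /x.
  have := tail_ge0 y i yP; have := tail_le1 y i yP.
  by have := tail_ge0 yb i ybP; have := tail_le1 yb i ybP; lra.
- by move=> i iK; rewrite ltW //= prob_vec_le1.
have KH : 0 <= K%:R * H by apply: mulr_ge0.
have E1 : K%:R * H * (2 * `|xa|) <= K%:R * H * (D * `|xa|).
  by rewrite ler_wpM2l // ler_wpM2r // /D; have := normr_ge0 Gam; lra.
have E2 : K%:R * H * (arrival m y + B) * d <= K%:R * H * D * d.
  rewrite ler_wpM2r // ler_wpM2l // /D lerD2r.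
  have := arrival_le m y yP; have := ler_norm Gam; lra.
by lra.
Qed.

(** Both estimates are used with [d = 0], the exact sign and [m = gamma]. At an equilibrium all
    fluxes vanish, so the left-hand sides are 0: the first estimate gives equal numbers of bikes in
    transit, and then the second gives equal tails. *)
Lemma equilibrium_unique_pos (z : 'rV[R]_K.+1) :
  is_prob_vec z -> (forall i, (i < K)%N -> flux lambda p g gamma z i = 0) ->
  0 <= arrival gamma z -> z = yb.
Proof.
move=> zP fz az.
have sgP : near_sign 0 Num.sg.
  move=> r; split.
  - by case: (ltgtP r 0) => r0; rewrite ?(ltr0_sg r0) ?(gtr0_sg r0) ?r0 ?sgr0
      ?normrN ?normr1 ?normr0.
  - by rewrite -normrEsg subrr.
  - by rewrite sgr_le0.
  - by rewrite sgr_ge0.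
have [c [C [c0 _ /(_ gamma 0 z Num.sg zP az (lexx _) (lexx _) sgP)]]] :=
  hub_estimate gamma.
rewrite big1 => [|i _]; last by rewrite fz // mulr0.
rewrite subrr normr0 addr0 mulr0 addr0 mulNr oppr_ge0 pmulr_rle0 // normr_le0 => /eqP xa.
have [h [D [_ _ _ /(_ gamma 0 z Num.sg zP az (lexx _) (lexx _) sgP)]]] :=
  tail_estimate gamma.
rewrite big1 => [|i _]; last by rewrite fz // mulr0.
rewrite xa normr0 addr0 mulr0 addr0 oppr_ge0 => S0.
apply/eqP; rewrite -subr_eq0 -scaleN1r; apply/eqP/vec_eq0 => k.
rewrite tailD tailZ mulN1r.
case: k => [|k]; first by rewrite !tail0 zP.2 ybP.2 subrr.
have [kK|Kk] := ltnP k K; last by rewrite !tail_over // subrr.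
apply/eqP; rewrite -normr_le0; apply: le_trans S0.
by rewrite (bigD1 (Ordinal kK)) //= lerDl sumr_ge0.
Qed.

End Reference.

(** A probability vector may hold more than [gamma] bikes per station. A negative arrival rate
    would, by the sign of the two terms of each flux, empty all levels below [K]; but stations that
    are all full lose bikes at rate [lambda], so the last flux would not vanish. *)
Lemma equilibrium_arrival_ge0 (gamma : R) (z : 'rV[R]_K.+1) :
  is_prob_vec z -> (forall i, (i < K)%N -> flux lambda p g gamma z i = 0) ->
  0 <= arrival gamma z.
Proof.
move=> zP fz; rewrite leNgt; apply/negP => a_lt0.
have [z0 z1] := zP; have /andP[p0 p1] := p01.
have G0 : 0 <= \sum_j z 0 j * g j by apply: sumr_ge0 => j _; rewrite mulr_ge0.
have dep0 n : 0 <= departure lambda p g z n.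
  rewrite mulr_ge0 ?(ltW lambda0) // addr_ge0 //; first by lra.
  by rewrite mulr_ge0 // divr_ge0.
have zn i : (i < K)%N -> z 0 (inord i) = 0.
  move=> /fz; rewrite /flux => E.
  have := mulr_ge0 (dep0 (inord i.+1)) (z0 (inord i.+1)).
  move: E => /eqP; rewrite subr_eq0 => /eqP <-.
  by rewrite nmulr_rge0 // => h; apply/eqP; rewrite eq_le h z0.
have others n : n != ord_max -> z 0 n = 0.
  move=> nK; rewrite -[n]inord_val zn // ltn_neqAle leq_ord andbT.
  by apply: contra nK => /eqP h; apply/eqP/val_inj.
have zK : z 0 ord_max = 1.
  by rewrite -z1 (bigD1 ord_max) //= big1 ?addr0.
have K1 : inord K.-1.+1 = ord_max :> 'I_K.+1.
  by apply: val_inj; rewrite /= prednK // inordK.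
have := fz K.-1; rewrite ltn_predL K0 => /(_ isT).
rewrite /flux K1 zn ?ltn_predL // zK mulr0 mulr1 sub0r /departure.
rewrite (bigD1 ord_max) //= big1 ?addr0 => [|n nK]; last by rewrite others ?mul0r.
rewrite zK mul1r divff ?gt_eqF ?g_gt0 // mulr1 subrK mulr1 => /eqP.
by rewrite oppr_eq0 gt_eqF.
Qed.

End Estimates.

(** * The generator on smoothed distances *)

Definition smooth_abs {R : realType} (d r : R) : R := Num.sqrt (r ^+ 2 + d ^+ 2).

(** The derivative of [smooth_abs d]. *)
Definition slope {R : realType} (d r : R) : R := r / smooth_abs d r.

Lemma smooth_abs_bounds {R : realType} (d r : R) : 0 <= d ->
  [/\ `|r| <= smooth_abs d r, d <= smooth_abs d r & smooth_abs d r <= `|r| + d].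
Proof.
move=> d0; split.
- by rewrite -sqrtr_sqr ler_wsqrtr // lerDl sqr_ge0.
- by rewrite -[leLHS](ger0_norm d0) -[leLHS]sqrtr_sqr ler_wsqrtr // lerDr sqr_ge0.
- have rd : 0 <= `|r| + d by rewrite addr_ge0.
  rewrite -[leRHS](ger0_norm rd) -[leRHS]sqrtr_sqr ler_wsqrtr // sqrrD.
  by rewrite real_normK ?num_real // lerD2r lerDl mulrn_wge0 // mulr_ge0.
Qed.

Lemma slope_near_sign {R : realType} (d : R) : 0 < d -> near_sign d (slope d).
Proof.
move=> d0 r; have [rf df fr] := smooth_abs_bounds d r (ltW d0).
have f0 : 0 < smooth_abs d r by apply: lt_le_trans df.
split.
- by rewrite normrM normfV (gtr0_norm f0) ler_pdivrMr // mul1r.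
- have -> : slope d r * r = `|r| ^+ 2 / smooth_abs d r.
    by rewrite real_normK ?num_real // /slope expr2 mulrAC.
  have -> : `|r| - `|r| ^+ 2 / smooth_abs d r =
    `|r| * (smooth_abs d r - `|r|) / smooth_abs d r by field; rewrite gt_eqF.
  rewrite ler_pdivrMr // mulrC ler_pM // ?subr_ge0 //; lra.
- by move=> r0; rewrite mulr_le0_ge0 // invr_ge0 ltW.
- by move=> r0; rewrite divr_ge0 // ltW.
Qed.

(** Second-order Taylor bound, the second derivative being at most [1 / d]. With
    [f = smooth_abs d r] and [A = (r + e) ^+ 2 + d ^+ 2], the right-hand side with [f] in place of
    [d] in the last denominator equals [(f ^+ 2 + A) / (2 * f)], which is at least [Num.sqrt A] by
    the inequality of the means. *)
Lemma smooth_abs_shift {R : realType} (d r e : R) : 0 < d ->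
  smooth_abs d (r + e) <= smooth_abs d r + e * slope d r + e ^+ 2 / (2 * d).
Proof.
move=> d0; have [rf df _] := smooth_abs_bounds d r (ltW d0).
have f0 : 0 < smooth_abs d r by apply: lt_le_trans df.
set f := smooth_abs d r.
have f2 : f ^+ 2 = r ^+ 2 + d ^+ 2 by rewrite sqr_sqrtr // addr_ge0 ?sqr_ge0.
have e2 : e ^+ 2 / (2 * f) <= e ^+ 2 / (2 * d).
  rewrite ler_wpM2l ?sqr_ge0 // lef_pV2 ?posrE ?mulr_gt0 //.
  by rewrite ler_pM2l.
apply: (@le_trans _ _ (f + e * slope d r + e ^+ 2 / (2 * f))); last by rewrite lerD2l.
have -> : f + e * slope d r + e ^+ 2 / (2 * f) =
    (f ^+ 2 + d ^+ 2 + (r + e) ^+ 2) / (2 * f).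
  by rewrite f2 /slope -/f; field: f2; rewrite gt_eqF.
set b := _ / _.
have b0 : 0 <= b by rewrite divr_ge0 ?addr_ge0 ?sqr_ge0 // mulr_ge0 // ltW.
rewrite -[leRHS](ger0_norm b0) -sqrtr_sqr ler_wsqrtr //.
rewrite /b expr_div_n ler_pdivlMr ?exprn_gt0 ?mulr_gt0 //.
rewrite exprMn f2 -subr_ge0.
have -> : (r ^+ 2 + d ^+ 2 + d ^+ 2 + (r + e) ^+ 2) ^+ 2 -
  ((r + e) ^+ 2 + d ^+ 2) * (2 ^+ 2 * (r ^+ 2 + d ^+ 2)) =
  (r ^+ 2 - (r + e) ^+ 2) ^+ 2 by ring.
exact: sqr_ge0.
Qed.

Section States.
Context {R : realType} {K N M : nat} (N0 : (0 < N)%N).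
Implicit Types c : state K N M.

Let NR0 : 0 < N%:R :> R. Proof. by rewrite ltr0n. Qed.

Lemma state_card c : (\sum_n val c n = N)%N.
Proof. by have /andP[/eqP] := valP c. Qed.

Lemma state_bikes c : (\sum_(n < K.+1) n * val c n <= M)%N.
Proof. by have /andP[] := valP c. Qed.

Lemma profileE c n : profile R c 0 n = (val c n)%:R / N%:R.
Proof. by rewrite mxE. Qed.

Lemma profile_inj : injective (@profile R K N M).
Proof.
move=> c c' /rowP E; apply/val_inj/ffunP => n; apply/val_inj/eqP.
have := E n; rewrite !profileE => /(divIf (lt0r_neq0 NR0))/eqP.
by rewrite eqr_nat.
Qed.

Lemma profile_prob_vec c : is_prob_vec (profile R c).
Proof.
split=> [n|]; first by rewrite profileE divr_ge0.
under eq_bigr do rewrite profileE.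
by rewrite -mulr_suml -natr_sum state_card divff // lt0r_neq0.
Qed.

Lemma profile_arrival c : arrival (M%:R / N%:R) (profile R c) =
  (M - \sum_(n < K.+1) n * val c n)%N%:R / N%:R.
Proof.
rewrite /arrival natrB ?state_bikes // mulrBl natr_sum mulr_suml.
by congr (_ - _); apply: eq_bigr => n _; rewrite profileE natrM mulrA.
Qed.

Lemma move_station c (n m : 'I_K.+1) : n != m -> (0 < val c n)%N ->
  (\sum_(i < K.+1) i * val c i + m <= M + n)%N ->
  exists c', profile R c' =
    profile R c + N%:R^-1 *: (delta_mx 0 m - delta_mx 0 n).
Proof.
move=> nm cn bikes.
pose v i := (val c i + (i == m) - (i == n))%N.
have vE i : (v i + (i == n) = val c i + (i == m))%N.
  by rewrite /v subnK //; case: eqP => // ->; rewrite addn_gt0 cn.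
have sum_eq (k : 'I_K.+1) (F : 'I_K.+1 -> nat) :
    (\sum_i F i * (i == k) = F k)%N.
  by rewrite (bigD1 k) //= eqxx muln1 big1 ?addn0 // => i /negbTE ->; rewrite muln0.
have v_sum : (\sum_i v i = N)%N.
  apply/eqP; rewrite -(eqn_add2r 1) -{2}(sum_eq m (fun=> 1%N)).
  rewrite -{1}(sum_eq n (fun=> 1%N)) -(state_card c) -!big_split /=.
  by apply/eqP/eq_bigr => i _; rewrite !mul1n vE.
have v_le i : (v i < N.+1)%N by rewrite ltnS -v_sum (bigD1 i) //= leq_addr.
have v_bikes : (\sum_(i < K.+1) i * v i <= M)%N.
  rewrite -(leq_add2r n); apply: leq_trans bikes.
  rewrite -{1}(sum_eq n (@nat_of_ord _)) -{1}(sum_eq m (@nat_of_ord _)).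
  rewrite -!big_split /= leq_eqVlt; apply/orP; left; apply/eqP.
  by apply: eq_bigr => i _; rewrite -!mulnDr vE.
pose f := [ffun i => Ordinal (v_le i)].
have fP : (\sum_(i < K.+1) f i == N)%N && (\sum_(i < K.+1) i * f i <= M)%N.
  apply/andP; split.
    by apply/eqP; rewrite -[RHS]v_sum; apply: eq_bigr => i _; rewrite ffunE.
  by apply: leq_trans v_bikes; apply: leq_sum => i _; rewrite ffunE.
exists (exist _ f fP : state K N M); apply/rowP => i.
rewrite profileE !mxE /= ffunE /=.
have : (v i)%:R + (i == n)%:R = (val c i)%:R + (i == m)%:R :> R.
  by rewrite -!natrD vE.
move=> /(canRL (addrK _)) ->; ring.
Qed.

Section Generator.
Context (lambda p : R) (g : 'I_K.+1 -> R).

Let sum_select c (F : 'rV[R]_K.+1 -> R) (z : 'rV[R]_K.+1) (w : R) :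
  w = 0 \/ (exists c' : state K N M, profile R c' = z) ->
  \sum_(c' : state K N M) (profile R c' == z)%:R * w *
     (F (profile R c') - F (profile R c)) = w * (F z - F (profile R c)).
Proof.
case=> [->|[c0 c0z]]; first by rewrite mul0r big1 // => c' _; rewrite mulr0 mul0r.
rewrite (bigD1 c0) //= c0z eqxx mul1r big1 ?addr0 // => c' cc0.
by rewrite -c0z (inj_eq profile_inj) (negbTE cc0) !mul0r.
Qed.

Let profile_neq0 c n : profile R c 0 n != 0 -> (0 < val c n)%N.
Proof. by rewrite profileE lt0n; apply: contra => /eqP ->; rewrite mul0r. Qed.

(** The sum over states becomes a sum over moves: a move whose target is not the profile of a state
    has rate 0, because the level to be left is empty or, for an arrival, no bike is in transit. *)
Lemma generatorE c (F : 'rV[R]_K.+1 -> R) (y := profile R c)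
    (a := arrival (M%:R / N%:R) y) :
  \sum_c' state_rate lambda p g c c' * (F (profile R c') - F y) =
  \sum_(i < K)
    (N%:R * (departure lambda p g y (inord i.+1) * y 0 (inord i.+1)) *
       (F (y + N%:R^-1 *: step_down R (inord i.+1)) - F y) +
     N%:R * (a * y 0 (inord i)) *
       (F (y + N%:R^-1 *: step_up R (inord i)) - F y)).
Proof.
rewrite /state_rate /rate -/y -/a.
under eq_bigr do rewrite mulr_suml.
rewrite exchange_big /=.
have E (n : 'I_K.+1) : \sum_(c' : state K N M)
    ((profile R c' == y + N%:R^-1 *: step_down R n)%:R *
       (N%:R * y 0 n * departure lambda p g y n * (0 < n)%N%:R) +
     (profile R c' == y + N%:R^-1 *: step_up R n)%:R *
       (N%:R * y 0 n * a * (n < K)%N%:R)) * (F (profile R c') - F y) =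
   N%:R * y 0 n * departure lambda p g y n * (0 < n)%N%:R *
     (F (y + N%:R^-1 *: step_down R n) - F y) +
   N%:R * y 0 n * a * (n < K)%N%:R * (F (y + N%:R^-1 *: step_up R n) - F y).
  under eq_bigr do rewrite mulrDl.
  rewrite big_split /=; congr (_ + _); apply: sum_select.
    have [n0|n0] := posnP n; first by left; rewrite mulr0.
    have [y0|/profile_neq0 cn] := eqVneq (y 0 n) 0.
      by left; rewrite y0 mulr0 !mul0r.
    have n1 : (inord n.-1 : 'I_K.+1) = n.-1 :> nat.
      by rewrite inordK // (leq_ltn_trans (leq_pred _)).
    right; apply: (move_station c n (inord n.-1)) => //.
      by rewrite -(inj_eq val_inj) /= n1 gtn_eqF // ltn_predL.
    by rewrite n1 leq_add ?state_bikes ?leq_pred.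
  have [nK|nK] := ltnP n K; last by left; rewrite mulr0.
  have [y0|/profile_neq0 cn] := eqVneq (y 0 n) 0.
    by left; rewrite y0 mulr0 !mul0r.
  have [a0|a0] := eqVneq a 0; first by left; rewrite a0 mulr0 mul0r.
  have n1 : (inord n.+1 : 'I_K.+1) = n.+1 :> nat by rewrite inordK.
  right; apply: (move_station c n (inord n.+1)) => //.
    by rewrite -(inj_eq val_inj) /= n1 ltn_eqF.
  rewrite n1 -addSnnS leq_add2r ltn_neqAle state_bikes andbT.
  by apply: contra a0 => /eqP h; rewrite /a profile_arrival h subnn mul0r.
rewrite (eq_bigr _ (fun n _ => E n)) !big_split /=; congr (_ + _).
  rewrite big_ord_recl /= mulr0 mul0r add0r; apply: eq_bigr => i _.
  have -> : lift ord0 i = inord i.+1 by apply: val_inj; rewrite /= inordK // ltnS.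
  by rewrite /=; ring.
rewrite big_ord_recr /= ltnn mulr0 mul0r addr0; apply: eq_bigr => i _.
have -> : widen_ord (leqnSn K) i = inord i.
  by apply: val_inj; rewrite /= inordK // ltnS ltnW.
by rewrite ltn_ord mulr1; ring.
Qed.

Hypotheses (lambda0 : 0 < lambda) (p01 : 0 <= p <= 1).
Hypothesis g0 : forall n : 'I_K.+1, 0 <= g n.

(** [h 0] is the weight of the bikes in transit. The function serves once with [h] constant 1 and
    once with the steep weights of [tail_estimate], for which [h 0 = 0]. *)
Definition lyapunov (h : nat -> R) (d m ab : R) (yb y : 'rV[R]_K.+1) : R :=
  \sum_(i < K) h i.+1 * smooth_abs d (tail y i.+1 - tail yb i.+1)
  + h 0 * smooth_abs d (arrival m y - ab).

Lemma lyapunov_shift (h : nat -> R) (d m ab : R) (yb y z : 'rV[R]_K.+1)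
    (e : R) (j : 'I_K) :
  0 < d -> (forall i, 0 <= h i) ->
  (forall i : 'I_K, tail z i.+1 = (i == j)%:R * e) ->
  lyapunov h d m ab yb (y + z) - lyapunov h d m ab yb y <=
  e * (h j.+1 * slope d (tail y j.+1 - tail yb j.+1)
       - h 0 * slope d (arrival m y - ab))
  + (h j.+1 + h 0) * (e ^+ 2 / (2 * d)).
Proof.
move=> d0 h0 zE.
have za : arrival m (y + z) - ab = arrival m y - ab + - e.
  rewrite !arrivalE; have -> : \sum_(i < K) tail (y + z) i.+1 =
      \sum_(i < K) tail y i.+1 + e.
    under eq_bigr do rewrite tailD zE.
    rewrite big_split /=; congr (_ + _).
    by rewrite (bigD1 j) //= eqxx mul1r big1 ?addr0 // => i /negbTE ->; rewrite mul0r.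
  by ring.
rewrite /lyapunov opprD addrACA -sumrB -mulrBr za.
have F0 : h 0 * (smooth_abs d (arrival m y - ab - e) -
    smooth_abs d (arrival m y - ab)) <=
    h 0 * (- e * slope d (arrival m y - ab) + e ^+ 2 / (2 * d)).
  rewrite ler_wpM2l // lerBlDl addrA.
  by have := smooth_abs_shift d (arrival m y - ab) (- e) d0; rewrite sqrrN.
have -> : \sum_(i < K) (h i.+1 * smooth_abs d (tail (y + z) i.+1 - tail yb i.+1) -
    h i.+1 * smooth_abs d (tail y i.+1 - tail yb i.+1)) =
    h j.+1 * (smooth_abs d (tail y j.+1 - tail yb j.+1 + e) -
              smooth_abs d (tail y j.+1 - tail yb j.+1)).
  rewrite (bigD1 j) //= big1 => [|i /negbTE ij]; last first.
    by rewrite tailD zE ij mul0r addr0 subrr.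
  by rewrite addr0 tailD zE eqxx mul1r addrAC mulrBr.
have Fj : h j.+1 * (smooth_abs d (tail y j.+1 - tail yb j.+1 + e) -
      smooth_abs d (tail y j.+1 - tail yb j.+1)) <=
    h j.+1 * (e * slope d (tail y j.+1 - tail yb j.+1) + e ^+ 2 / (2 * d)).
  rewrite ler_wpM2l // lerBlDl addrA.
  exact: smooth_abs_shift.
by apply: le_trans (lerD Fj F0) _; rewrite le_eqVlt; apply/orP; left; apply/eqP; ring.
Qed.

(** The first-order parts of the jumps add up to the mean field derivative. A jump of size [1/N] has
    a second-order part of at most [H / (N^2 d)], and the total jump rate is at most
    [N (m + lambda)]: arrivals per station are bounded by [m], and departures by [lambda] because
    the service shares sum to at most 1. *)
Lemma generator_lyapunov_le c (h : nat -> R) (d ab H : R) (yb : 'rV[R]_K.+1)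
    (y := profile R c) (m := M%:R / N%:R) :
  0 < d -> (forall i, 0 <= h i <= H) ->
  \sum_c' state_rate lambda p g c c' *
    (lyapunov h d m ab yb (profile R c') - lyapunov h d m ab yb y) <=
  \sum_(i < K) (h i.+1 * slope d (tail y i.+1 - tail yb i.+1)
                - h 0 * slope d (arrival m y - ab)) * flux lambda p g m y i
  + H * (m + lambda) / (N%:R * d).
Proof.
move=> d0 hH; have h0 i : 0 <= h i by case/andP: (hH i).
have hle i : h i <= H by case/andP: (hH i).
have yP : is_prob_vec y by apply: profile_prob_vec.
have [y0 y1] := yP.
have Nd : 0 < N%:R * d by rewrite mulr_gt0.
have a0 : 0 <= arrival m y by rewrite /y /m profile_arrival divr_ge0.
have /andP[p0 p1] := p01.
have dep0 n : 0 <= departure lambda p g y n.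
  rewrite mulr_ge0 ?(ltW lambda0) // addr_ge0 //; first by rewrite subr_ge0.
  rewrite mulr_ge0 // divr_ge0 //; apply: sumr_ge0 => j _; exact: mulr_ge0.
rewrite generatorE -/y -/m.
pose Dn i := departure lambda p g y (inord i.+1) * y 0 (inord i.+1).
pose Ar i := arrival m y * y 0 (inord i).
have Dn0 i : 0 <= Dn i by apply: mulr_ge0.
have Ar0 i : 0 <= Ar i by apply: mulr_ge0.
pose L i := h i.+1 * slope d (tail y i.+1 - tail yb i.+1)
            - h 0 * slope d (arrival m y - ab).
have Ni : 0 < N%:R^-1 :> R by rewrite invr_gt0.
have down (i : 'I_K) : N%:R * Dn i *
    (lyapunov h d m ab yb (y + N%:R^-1 *: step_down R (inord i.+1))
      - lyapunov h d m ab yb y) <= - L i * Dn i + Dn i * (H / (N%:R * d)).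
  have := lyapunov_shift h d m ab yb y (N%:R^-1 *: step_down R (inord i.+1))
    (- N%:R^-1) i d0 h0.
  have iE : (inord i.+1 : 'I_K.+1) = i.+1 :> nat by rewrite inordK ?ltnS.
  have zE (k : 'I_K) : tail (N%:R^-1 *: step_down R (inord i.+1 : 'I_K.+1)) k.+1 =
      (k == i)%:R * - N%:R^-1 :> R.
    by rewrite tailZ tail_step_down iE // eqSS mulrN mulrC mulrN.
  move=> /(_ zE) B.
  have ND : 0 <= N%:R * Dn i by rewrite mulr_ge0.
  apply: le_trans (ler_wpM2l ND B) _; rewrite sqrrN -/(L i).
  have -> : N%:R * Dn i * (- N%:R^-1 * L i +
     (h i.+1 + h 0) * (N%:R^-1 ^+ 2 / (2 * d))) =
     - L i * Dn i + Dn i * ((h i.+1 + h 0) / 2 / (N%:R * d)).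
    by field; rewrite !gt_eqF.
  rewrite lerD2l ler_wpM2l // ler_wpM2r ?invr_ge0 ?(ltW Nd) //.
  by have := hle i.+1; have := hle 0; lra.
have up (i : 'I_K) : N%:R * Ar i *
    (lyapunov h d m ab yb (y + N%:R^-1 *: step_up R (inord i))
      - lyapunov h d m ab yb y) <= L i * Ar i + Ar i * (H / (N%:R * d)).
  have := lyapunov_shift h d m ab yb y (N%:R^-1 *: step_up R (inord i))
    (N%:R^-1) i d0 h0.
  have iE : (inord i : 'I_K.+1) = i :> nat by rewrite inordK // ltnS ltnW.
  have zE (k : 'I_K) : tail (N%:R^-1 *: step_up R (inord i : 'I_K.+1)) k.+1 =
      (k == i)%:R * N%:R^-1 :> R.
    by rewrite tailZ tail_step_up iE // eqSS mulrC.
  move=> /(_ zE) B.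
  have ND : 0 <= N%:R * Ar i by rewrite mulr_ge0.
  apply: le_trans (ler_wpM2l ND B) _; rewrite -/(L i).
  have -> : N%:R * Ar i * (N%:R^-1 * L i +
     (h i.+1 + h 0) * (N%:R^-1 ^+ 2 / (2 * d))) =
     L i * Ar i + Ar i * ((h i.+1 + h 0) / 2 / (N%:R * d)).
    by field; rewrite !gt_eqF.
  rewrite lerD2l ler_wpM2l // ler_wpM2r ?invr_ge0 ?(ltW Nd) //.
  by have := hle i.+1; have := hle 0; lra.
apply: (@le_trans _ _ (\sum_(i < K) (L i * flux lambda p g m y i
    + (Dn i + Ar i) * (H / (N%:R * d))))).
  apply: ler_sum => i _; apply: le_trans (lerD (down i) (up i)) _.
  by rewrite /flux -/(Dn i) -/(Ar i); lra.
rewrite big_split /= lerD2l -mulr_suml.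
have -> : H * (m + lambda) / (N%:R * d) = (m + lambda) * (H / (N%:R * d)) by ring.
rewrite ler_wpM2r //.
  by rewrite divr_ge0 ?(ltW Nd) // (le_trans (h0 0)).
rewrite big_split /= addrC; apply: lerD.
  rewrite -mulr_sumr; apply: le_trans (arrival_le m y yP).
  rewrite ler_piMr // -y1 big_ord_recr /= -[leLHS]addr0 lerD //.
  apply: ler_sum => i _.
  rewrite (_ : inord i = widen_ord (leqnSn K) i) //; apply: val_inj.
  by rewrite /= inordK // ltnS ltnW.
have -> : \sum_(i < K) Dn i = lambda * ((1 - p) * \sum_(i < K) y 0 (inord i.+1)
   + p * \sum_(i < K) g (inord i.+1) * y 0 (inord i.+1) / \sum_j y 0 j * g j).
  rewrite !mulr_sumr -big_split mulr_sumr; apply: eq_bigr => i _ /=.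
  by rewrite /Dn /departure; ring.
rewrite -[leRHS]mulr1 ler_pM2l //.
have S1 := service_share_le1 g g0 y yP.
have S2 : \sum_(i < K) y 0 (inord i.+1) <= 1.
  rewrite -y1 big_ord_recl /= -[leLHS]add0r lerD //.
  apply: ler_sum => i _.
  by rewrite (_ : inord i.+1 = lift ord0 i) //; apply: val_inj; rewrite /= inordK // ltnS.
have q0 : 0 <= 1 - p by rewrite subr_ge0.
by have := ler_wpM2l q0 S2; have := ler_wpM2l p0 S1; lra.
Qed.

End Generator.
End States.

(** * Invariant distributions *)

Lemma cvg_fin_sum {R : realType} (I T : Type) (F : set_system T) {FF : Filter F}
    (r : seq I) (f : I -> T -> R) (l : I -> R) :
  (forall i, f i x @[x --> F] --> l i) ->
  \sum_(i <- r) f i x @[x --> F] --> \sum_(i <- r) l i.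
Proof.
move=> fl; elim: r => [|i r IH].
  rewrite big_nil; under eq_fun do rewrite big_nil; exact: cvg_cst.
rewrite big_cons; under eq_fun do rewrite big_cons.
by apply: cvgD; [exact: fl | exact: IH].
Qed.

(** For every [h > 0] the mean under [w] of the difference quotient of [f] is exactly 0 by
    invariance; the claim is its limit at 0. The diagonal of [q] never enters, since [f j - f i]
    vanishes there. *)
Lemma stationary_generator {R : realType} {S : finType} (q : S -> S -> R)
    (P : R -> S -> S -> R) (w f : S -> R) :
  has_transition_rates q P ->
  (forall t j, 0 <= t -> \sum_i w i * P t i j = w j) ->
  \sum_i w i * (\sum_j q i j * (f j - f i)) = 0.
Proof.
move=> [_ Psum _ _ Prate] wP.
pose L h := \sum_i w i * (\sum_j h^-1 * P h i j * (f j - f i)).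
have Lq : L h @[h --> 0^'+] --> \sum_i w i * (\sum_j q i j * (f j - f i)).
  apply: cvg_fin_sum => i; apply: cvgM; first exact: cvg_cst.
  apply: cvg_fin_sum => j; have [<-|ij] := eqVneq i j.
    by rewrite subrr mulr0; under eq_fun do rewrite mulr0; exact: cvg_cst.
  by apply: cvgM; [exact: Prate | exact: cvg_cst].
have L0 : L h @[h --> 0^'+] --> 0.
  apply: cvg_near_cst; near=> h.
  have h0 : 0 <= h by apply: ltW.
  have -> : L h = h^-1 * (\sum_j (\sum_i w i * P h i j) * f j
                          - \sum_i w i * f i * \sum_j P h i j).
    rewrite /L mulrBr !mulr_sumr.
    under [X in _ = X - _]eq_bigr do rewrite mulr_suml mulr_sumr.
    rewrite [X in _ = X - _]exchange_big -sumrB; apply: eq_bigr => i _ /=.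
    rewrite mulrA !mulr_sumr -sumrB; apply: eq_bigr => j _; ring.
  under eq_bigr do rewrite wP //.
  under [X in _ - X]eq_bigr do rewrite Psum // mulr1.
  by rewrite subrr mulr0.
exact: (cvg_unique _ Lq L0).
Unshelve. all: by end_near. Qed.

(** * Laws with finitely many atoms, and convergence to a Dirac mass *)

Section BorelRow.
Context {R : realType} {n : nat}.

Lemma borel_open (A : set 'rV[R]_n.+1) : open A ->
  measurable (A : set (borel R n.+1)).
Proof. by move=> oA; exact: sub_sigma_algebra. Qed.

Lemma borel_set1 (y : 'rV[R]_n.+1) : measurable ([set y] : set (borel R n.+1)).
Proof.
rewrite -[X in measurable X]setCK; apply: measurableC; apply: borel_open.
apply: closed_openC; apply: accessible_closed_set1; apply: hausdorff_accessible.
exact: norm_hausdorff.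
Qed.

Lemma continuous_borel (f : 'rV[R]_n.+1 -> R) : continuous f ->
  measurable_fun [set: borel R n.+1] (f : borel R n.+1 -> R).
Proof.
move=> fc; apply: (measurability _ (RGenOpens.measurableE R)).
move=> _ [_ [a [b ->] <-]]; rewrite setTI; apply: borel_open.
by move/continuousP : fc; apply; exact: interval_open.
Qed.

Context {S : finType} (Y : S -> 'rV[R]_n.+1) (Yinj : injective Y).
Context (nu : probability (borel R n.+1) R) (nuY : nu (range Y) = 1%E).

Let rangeE : range Y = \big[setU/set0]_(c <- index_enum S) [set Y c].
Proof.
rewrite -bigcup_seq; apply/seteqP; split=> [_ [c _ <-]|_ [c _ ->]].
  by exists c => //=; rewrite mem_index_enum.
by exists c.
Qed.

Let trivY : trivIset [set` index_enum S] (fun c => [set Y c]).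
Proof. by move=> c c' _ _ [y [-> /Yinj]]. Qed.

Let mrange : measurable (range Y : set (borel R n.+1)).
Proof. by rewrite rangeE; apply: bigsetU_measurable => c _; exact: borel_set1. Qed.

Lemma integral_atoms (f : 'rV[R]_n.+1 -> R) : continuous f ->
  (exists C, forall x, `|f x| <= C) ->
  (\int[nu]_x (f x)%:E)%E = (\sum_c fine (nu [set Y c]) * f (Y c))%:E.
Proof.
move=> fc [C fC].
have mf := continuous_borel f fc.
have mT : measurable [set: borel R n.+1] by exact: measurableT.
have fint : nu.-integrable setT (EFin \o (f : borel R n.+1 -> R)).
  apply: measurable_bounded_integrable => //.
    by rewrite -ge0_fin_numE // fin_num_measure.
  exists C; split; rewrite ?num_real // => D CD x _ /=.
  by apply: le_trans (fC x) _; apply: ltW.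
have null : nu (~` range Y) = 0%E.
  by rewrite probability_setC // nuY subee.
rewrite (@negligible_integral _ _ _ nu setT (~` range Y)) //; last exact: measurableC.
rewrite setTD setCK rangeE integral_bigsetU_EFin //.
- rewrite -sumEFin; apply: eq_bigr => c _.
  rewrite (eq_integral (cst (f (Y c))%:E)) => [|x]; last by rewrite inE => ->.
  rewrite integral_cst; last exact: borel_set1.
  by rewrite muleC EFinM fineK // fin_num_measure //; exact: borel_set1.
- by move=> c; exact: borel_set1.
- exact: index_enum_uniq.
- apply: (measurable_funS measurableT) => //.
  exact/measurable_EFinP.
Qed.

Lemma atom_sum : \sum_c fine (nu [set Y c]) = 1.
Proof.
have c1 : continuous ((fun=> 1) : 'rV[R]_n.+1 -> R) by exact: cst_continuous.
have i1 : (\int[nu]_x (1 : R)%:E = 1)%E.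
  by rewrite integral_cst // mul1e; exact: probability_setT.
apply/EFin_inj; rewrite -[RHS]i1 (integral_atoms _ c1); last first.
  by exists 1 => x; rewrite normr1.
by congr EFin; apply: eq_bigr => c _; rewrite mulr1.
Qed.

End BorelRow.

(** Convergence in mean suffices: near [yb] the test function varies by at most [e / 2], and at
    distance at least [h] its variation, at most [2 * C], is dominated by [2 * C / h] times the
    distance. *)
Lemma converges_weakly_dirac {R : realType} {n : nat}
    (mu : nat -> probability (borel R n.+1) R) (yb : 'rV[R]_n.+1)
    (S : nat -> finType) (Y : forall N, S N -> 'rV[R]_n.+1)
    (r : nat -> R) :
  (forall N, (0 < N)%N -> injective (Y N)) ->
  (forall N, (0 < N)%N -> mu N (range (Y N)) = 1%E) ->
  (forall N, (0 < N)%N -> \sum_c fine (mu N [set Y N c]) * `|Y N c - yb| <= r N) ->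
  r @ \oo --> 0 ->
  converges_weakly mu (\d_(yb : borel R n.+1)).
Proof.
move=> Yinj muY Er r0 f fc [C fC].
rewrite integral_dirac //; last first.
  by apply/measurable_EFinP; exact: continuous_borel.
rewrite diracT mul1e.
have C0 : 0 <= C by apply: le_trans (fC 0).
pose E N := \sum_c fine (mu N [set Y N c]) * f (Y N c).
suff Ef : E @ \oo --> f yb.
  apply: (@cvg_trans _ ((fun N => (E N)%:E) @ \oo)); last first.
    by apply/fine_cvgP; split; [exact: nearW | exact: Ef].
  apply: near_eq_cvg; near=> N.
  have N0 : (0 < N)%N by near: N; exists 1%N.
  rewrite (@integral_atoms _ _ _ (Y N) (Yinj N N0) (mu N) (muY N N0) f fc) //.
  by exists C.
apply/cvgrPdist_le => e e0.
have e20 : 0 < e / 2 by rewrite divr_gt0.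
have /cvgrPdist_le/(_ _ e20)/nbhs_ballP[h /= h0 hball] := fc yb.
(* The added 1 keeps the divisor positive when [C = 0]. *)
have C1 : 0 < 2 * C / h + 1 by rewrite ltr_wpDl // divr_ge0 ?mulr_ge0 // ltW.
have e'0 : 0 < e / 2 / (2 * C / h + 1) by rewrite divr_gt0.
have /cvgrPdist_le/(_ _ e'0) r0e := r0.
near=> N.
have N0 : (0 < N)%N by near: N; exists 1%N.
have rN : `|0 - r N| <= e / 2 / (2 * C / h + 1) by near: N.
have w0 c : 0 <= fine (mu N [set Y N c]) by rewrite fine_ge0.
have w1 : \sum_c fine (mu N [set Y N c]) = 1.
  by apply: atom_sum; [exact: Yinj | exact: muY].
rewrite /E -[f yb]mul1r -w1 mulr_suml -sumrB.
apply: le_trans (ler_norm_sum _ _ _) _.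
apply: (@le_trans _ _ (\sum_c (fine (mu N [set Y N c]) * (e / 2) +
   fine (mu N [set Y N c]) * `|Y N c - yb| * (2 * C / h)))).
  apply: ler_sum => c _; rewrite -mulrBr normrM ger0_norm // -mulrA -mulrDr.
  rewrite ler_wpM2l //.
  have [near_yb|far] := ltP `|Y N c - yb| h.
    apply: (@le_trans _ _ (e / 2)).
      by apply: hball; rewrite -ball_normE /= distrC.
    by rewrite lerDl mulr_ge0 // divr_ge0 ?mulr_ge0 // ltW.
  apply: (@le_trans _ _ (2 * C)).
    apply: le_trans (ler_normB _ _) _.
    by have := fC yb; have := fC (Y N c); lra.
  rewrite ler_wpDl ?(ltW e20) // mulrCA ler_peMr ?mulr_ge0 // ler_pdivlMr //.
  by rewrite mul1r.
rewrite big_split /= -!mulr_suml w1 mul1r.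
have rN' : r N <= e / 2 / (2 * C / h + 1).
  by move: rN; rewrite sub0r normrN; apply: le_trans; exact: ler_norm.
have Ch0 : 0 <= 2 * C / h by rewrite divr_ge0 ?mulr_ge0 // ltW.
have := ler_wpM2r Ch0 (le_trans (Er N N0) rN').
have : e / 2 / (2 * C / h + 1) * (2 * C / h) <= e / 2.
  rewrite -mulrA ler_piMr ?(ltW e20) // mulrC ler_pdivrMr // mul1r lerDl //.
lra.
Unshelve. all: by end_near. Qed.

Lemma norm_le_tails {R : realType} {K : nat} (y z : 'rV[R]_K.+1) :
  is_prob_vec y -> is_prob_vec z ->
  `|y - z| <= 2 * \sum_(i < K) `|tail y i.+1 - tail z i.+1|.
Proof.
move=> [_ y1] [_ z1]; set S := \sum_(i < K) _.
have S0 : 0 <= S by apply: sumr_ge0.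
have xS k : `|tail y k - tail z k| <= S.
  case: k => [|k]; first by rewrite !tail0 y1 z1 subrr normr0.
  have [kK|Kk] := ltnP k K; last by rewrite !tail_over // subrr normr0.
  by rewrite /S (bigD1 (Ordinal kK)) //= lerDl sumr_ge0.
have [|/mx_norm_neq0[[i j] E]] := eqVneq (mx_norm (y - z)) 0.
  by move=> E; rewrite [`|_|]E mulr_ge0.
rewrite [`|_|]E /= ord1 !mxE -[j]inord_val !tail_pred ?leq_ord //.
have -> : tail y j - tail y j.+1 - (tail z j - tail z j.+1) =
  (tail y j - tail z j) - (tail y j.+1 - tail z j.+1).
  by move: (tail y j) (tail y j.+1) (tail z j) (tail z j.+1) => *; ring.
apply: le_trans (ler_normB _ _) _.
have := xS j; have := xS j.+1; lra.
Qed.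

(** * Mean distance to the equilibrium under the invariant law *)

Section Stationary.
Context {R : realType} {K : nat} (lambda p : R) (g : 'I_K.+1 -> R).
Hypotheses (K0 : (0 < K)%N) (lambda0 : 0 < lambda) (p01 : 0 <= p <= 1).
Hypothesis gmono : forall m n : 'I_K.+1, (m <= n)%N -> g m <= g n.
Hypothesis g0 : forall n : 'I_K.+1, 0 <= g n.
Hypothesis g_gt0 : forall n : 'I_K.+1, (0 < n)%N -> 0 < g n.

(** The constant depends on neither the chain nor [d], so that [d] can be chosen afterwards as a
    function of [N]. It arises by inserting the bound [XE'] on the mean deviation of the bikes in
    transit into the bound [TE] for the tails. *)
Lemma stationary_tail_estimate (gamma : R) (yb : 'rV[R]_K.+1) (Gam : R) :
  is_prob_vec yb -> (forall n, 0 < yb 0 n) -> 0 < arrival gamma yb ->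
  (forall i, (i < K)%N -> flux lambda p g gamma yb i = 0) -> 0 <= Gam ->
  exists C : R, forall (N M : nat) (P : R -> state K N M -> state K N M -> R)
    (w : state K N M -> R) (d : R) (m := M%:R / N%:R),
    (0 < N)%N -> m <= Gam -> 0 < d ->
    has_transition_rates (@state_rate R K lambda p g N M) P ->
    (forall t j, 0 <= t -> \sum_i w i * P t i j = w j) ->
    (forall c, 0 <= w c) -> \sum_c w c = 1 ->
    \sum_c w c * (\sum_(i < K) `|tail (profile R c) i.+1 - tail yb i.+1|) <=
    C * (d + `|m - gamma| + (N%:R * d)^-1).
Proof.
move=> ybP yb0 ab0 fb Gam0.
have [c [C [c0 C0 hub]]] :=
  hub_estimate lambda p g K0 lambda0 p01 gmono g0 g_gt0 gamma yb ybP yb0 fb Gam.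
have [h [D [D0 h00 hD tailE]]] :=
  tail_estimate lambda p g K0 lambda0 p01 gmono g0 g_gt0 gamma yb ybP yb0 ab0 fb Gam.
pose L := Gam + lambda.
have L0 : 0 <= L by apply: addr_ge0 => //; apply: ltW.
exists (D * ((C + L) / c + 1) + D * L).
move=> N M P w d m N0 mG d0 PQ wP w0 w1.
have Nd : 0 < N%:R * d by rewrite mulr_gt0 // ltr0n.
have Nd' : 0 <= (N%:R * d)^-1 by rewrite invr_ge0 ltW.
pose X (c : state K N M) : R := `|arrival m (profile R c) - arrival gamma yb|.
pose T (c : state K N M) : R := \sum_(i < K) `|tail (profile R c) i.+1 - tail yb i.+1|.
rewrite -/(\sum_c w c * T c).
have sP : near_sign d (slope d) by apply: slope_near_sign.
(* The generator applied to [lyapunov] has mean 0 under [w], so the average of any upper bound for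
   it is nonnegative. *)
have gen (k : nat -> R) (H : R) (B : state K N M -> R) :
    (forall i, 0 <= k i <= H) ->
    (forall c, \sum_(i < K) (k i.+1 * slope d (tail (profile R c) i.+1 - tail yb i.+1)
       - k 0%N * slope d (arrival m (profile R c) - arrival gamma yb))
       * flux lambda p g m (profile R c) i <= B c) ->
    0 <= \sum_c w c * B c + H * L * (N%:R * d)^-1.
  move=> kH kB.
  have H0 : 0 <= H by have /andP[k0 /(le_trans k0)] := kH 0%N.
  rewrite -[leLHS](stationary_generator _ _ w
    (fun c => lyapunov k d m (arrival gamma yb) yb (profile R c)) PQ wP).
  rewrite -[H * L * _]mul1r -[X in X * (H * L * _)]w1 mulr_suml -big_split /=.
  apply: ler_sum => c' _; rewrite -mulrDr ler_wpM2l //.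
  apply: le_trans (generator_lyapunov_le N0 lambda p g lambda0 p01 g0 c' k d
    (arrival gamma yb) H yb d0 kH) _.
  apply: lerD; first exact: kB.
  by rewrite ler_wpM2r // ler_wpM2l // lerD2r.
have XE : c * (\sum_c w c * X c) <= C * (d + `|m - gamma|) + L * (N%:R * d)^-1.
  have := gen (fun=> 1) 1 (fun c' => - c * X c' + C * (d + `|m - gamma|)).
  rewrite mul1r => H.
  have {H} : 0 <= \sum_c0 w c0 * (- c * X c0 + C * (d + `|m - gamma|)) +
      L * (N%:R * d)^-1.
    apply: H => [i|c']; first by rewrite ler01 lexx.
    rewrite (eq_bigr (fun i : 'I_K =>
      (slope d (tail (profile R c') i.+1 - tail yb i.+1)
        - slope d (arrival m (profile R c') - arrival gamma yb))
      * flux lambda p g m (profile R c') i)); last by move=> i _; rewrite !mul1r.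
    apply: hub => //; first exact: profile_prob_vec.
      by rewrite profile_arrival divr_ge0.
    exact: ltW.
  under eq_bigr do rewrite mulrDr mulrCA.
  by rewrite big_split /= -mulr_sumr -mulr_suml w1; lra.
have TE : \sum_c w c * T c <= D * (\sum_c w c * X c + d) + D * L * (N%:R * d)^-1.
  have H := gen h D (fun c' => - T c' + D * (X c' + d)) hD.
  have {H} : 0 <= \sum_c0 w c0 * (- T c0 + D * (X c0 + d)) +
      D * L * (N%:R * d)^-1.
    apply: H => c'.
    rewrite (eq_bigr (fun i : 'I_K =>
      (h i.+1 * slope d (tail (profile R c') i.+1 - tail yb i.+1))
      * flux lambda p g m (profile R c') i)); last first.
      by move=> i _; rewrite h00 mul0r subr0.
    apply: tailE => //; first exact: profile_prob_vec.
      by rewrite profile_arrival divr_ge0.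
    exact: ltW.
  have -> : \sum_c0 w c0 * (- T c0 + D * (X c0 + d)) =
      - (\sum_c w c * T c) + D * (\sum_c w c * X c) + D * d.
    rewrite -[D * d]mul1r -w1 mulr_suml mulr_sumr -sumrN -!big_split /=.
    by apply: eq_bigr => c' _; ring.
  by rewrite mulrDr; lra.
set E := d + `|m - gamma| + (N%:R * d)^-1.
have E0 : 0 <= E by rewrite !addr_ge0 // ltW.
have dE : d <= E by rewrite /E -addrA lerDl addr_ge0.
have NE : (N%:R * d)^-1 <= E by rewrite /E lerDr addr_ge0 // ltW.
have XE' : \sum_c w c * X c <= (C + L) / c * E.
  have dmE : d + `|m - gamma| <= E by rewrite /E lerDl.
  rewrite mulrAC ler_pdivlMr // [leLHS]mulrC; apply: le_trans XE _.
  by have := ler_wpM2l C0 dmE; have := ler_wpM2l L0 NE; lra.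
apply: le_trans TE _.
have := ler_wpM2l D0 XE'; have := ler_wpM2l D0 dE.
have := ler_wpM2l (mulr_ge0 D0 L0) NE; lra.
Qed.

End Stationary.

(** * Equilibrium and weak limit *)

Lemma mean_field_limit {R : realType} {K : nat} (lambda p gamma : R)
    (g : 'I_K.+1 -> R) (M : nat -> nat)
    (P : forall N : nat, R -> state K N (M N) -> state K N (M N) -> R)
    (ybarN : nat -> probability (borel R K.+1) R) :
  (0 < K)%N -> 0 < lambda -> 0 <= p <= 1 ->
  (forall m n : 'I_K.+1, (m <= n)%N -> g m <= g n) ->
  (forall n : 'I_K.+1, 0 <= g n) ->
  (forall n : 'I_K.+1, (0 < n)%N -> 0 < g n) ->
  0 < p \/ 0 < g ord0 ->
  (M N)%:R / N%:R @[N --> \oo] --> gamma ->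
  (g ord0 = 0 -> gamma = 0 \/ p * lambda < gamma) ->
  (forall N : nat, (0 < N)%N ->
    has_transition_rates (@state_rate R K lambda p g N (M N)) (P N)) ->
  (forall N : nat, (0 < N)%N ->
    invariant_distribution (@profile R K N (M N)) (P N) (ybarN N)) ->
  exists ybar : 'rV[R]_K.+1,
    [/\ is_equilibrium lambda p gamma g ybar,
        forall z, is_equilibrium lambda p gamma g z -> z = ybar
      & converges_weakly ybarN (\d_(ybar : borel R K.+1))].
Proof.
move=> K0 lambda0 p01 gmono g0 g_gt0 pg hM hgamma hP hinv.
have gamma_ge0 : 0 <= gamma by apply: (cvgr_to_ge hM); apply: nearW => N; exact: divr_ge0.
have Yinj N : (0 < N)%N -> injective (@profile R K N (M N)) by exact: profile_inj.
have nuY N : (0 < N)%N -> ybarN N (range (@profile R K N (M N))) = 1%E.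
  by move=> /hinv[].
pose w N (c : state K N (M N)) : R := fine (ybarN N [set profile R c]).
have w0 N (c : state K N (M N)) : 0 <= w N c by rewrite fine_ge0.
have w1 N : (0 < N)%N -> \sum_(c : state K N (M N)) w N c = 1.
  by move=> N0; apply: atom_sum; [exact: Yinj | exact: nuY].
have arr0 N (c : state K N (M N)) : (0 < N)%N ->
    0 <= arrival ((M N)%:R / N%:R) (profile R c).
  by move=> N0; rewrite profile_arrival divr_ge0.
(* For [gamma = 0] the equilibrium is the empty system, which has neither positive coordinates nor a
   positive arrival rate, so the estimates above do not apply. Convergence is then direct: the sum
   of the tails is the number of bikes at stations, per station, and is at most [M/N]. *)
move: gamma_ge0; rewrite le_eqVlt => /orP[/eqP gammaE|gamma_gt0].
  pose yb : 'rV[R]_K.+1 := delta_mx 0 ord0.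
  have tyb i : tail yb i.+1 = 0 by rewrite tail_delta.
  have ybP : is_prob_vec yb.
    by split=> [n|]; [rewrite mxE; case: eqP | rewrite -tail0 tail_delta].
  have ab : arrival gamma yb = 0.
    by rewrite arrivalE -gammaE big1 ?subr0 // => i _; exact: tyb.
  exists yb; split.
  - split=> //; apply/drift_eq0 => k kK; rewrite /flux ab mul0r sub0r.
    by rewrite tail_pred // !tyb subrr mulr0 oppr0.
  - move=> z [zP /drift_eq0 fz].
    have := equilibrium_arrival_ge0 lambda p g K0 lambda0 p01 g0 g_gt0 gamma z zP fz.
    rewrite arrivalE -gammaE sub0r oppr_ge0 => S0.
    apply/eqP; rewrite -subr_eq0; apply/eqP/vec_eq0 => k.
    rewrite tailD -scaleN1r tailZ mulN1r.
    case: k => [|k]; first by rewrite !tail0 zP.2 ybP.2 subrr.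
    rewrite tyb subr0.
    have [kK|Kk] := ltnP k K; last by rewrite tail_over.
    apply/eqP; rewrite eq_le tail_ge0 // andbT; apply: le_trans S0.
    rewrite (bigD1 (Ordinal kK)) //= lerDl sumr_ge0 // => i _.
    exact: tail_ge0.
  - apply: (@converges_weakly_dirac R K ybarN yb (fun N => state K N (M N))
      (fun N => @profile R K N (M N)) (fun N => 2 * ((M N)%:R / N%:R))) => //.
      move=> N N0.
      rewrite -[leRHS]mul1r -[X in _ <= X * _](w1 _ N0) mulr_suml.
      apply: ler_sum => c _.
      apply: ler_wpM2l; first exact: (w0 N c).
      have cP : is_prob_vec (profile R c) by exact: profile_prob_vec.
      apply: le_trans (norm_le_tails _ _ cP ybP) _; rewrite ler_wpM2l //.
      have -> : \sum_(i < K) `|tail (profile R c) i.+1 - tail yb i.+1| =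
          \sum_(i < K) tail (profile R c) i.+1.
        by apply: eq_bigr => i _; rewrite tyb subr0 ger0_norm ?tail_ge0.
      by have := arr0 _ c N0; rewrite arrivalE subr_ge0.
    rewrite -[0](mulr0 2) gammaE; apply: cvgM => //; exact: cvg_cst.
pose gn n := g (inord (minn n K)).
have gn_gt0 i : 0 < gn i.+1.
  by apply: g_gt0; rewrite inordK ?ltnS ?geq_minr // leq_min K0.
have gn_mono i : gn i <= gn i.+1.
  apply: gmono; rewrite !inordK ?ltnS ?geq_minr //.
  by rewrite leq_min geq_minr andbT geq_min leqnSn.
have gn0 : gn 0%N = g ord0.
  by rewrite /gn min0n; congr g; apply: val_inj; rewrite /= inordK.
have gnE (n : 'I_K.+1) : gn n = g n.
  by rewrite /gn (minn_idPl (leq_ord n)) inord_val.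
have hg' : gn 0%N = 0 -> p * lambda < gamma.
  by rewrite gn0 => /hgamma[gz|//]; move: gamma_gt0; rewrite gz ltxx.
rewrite -gn0 in pg.
have gn00 : 0 <= gn 0%N by rewrite gn0.
have [x [a [G [x_gt0 x1 GE aE [a_gt0 _ xflux]]]]] :=
  mean_field_equilibrium_exists K lambda p gamma gn K0 lambda0 p01 gamma_gt0
    gn_gt0 gn00 gn_mono pg hg'.
pose yb : 'rV[R]_K.+1 := \row_n x n.
have ybE n : yb 0 n = x n by rewrite mxE.
have yb_gt0 n : 0 < yb 0 n by rewrite ybE x_gt0 ?leq_ord.
have ybP : is_prob_vec yb.
  by split=> [n|]; [exact: ltW | rewrite -x1; apply: eq_bigr => n _; rewrite ybE].
have abE : arrival gamma yb = a.
  by rewrite aE /arrival; congr (_ - _); apply: eq_bigr => n _; rewrite ybE.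
have ab_gt0 : 0 < arrival gamma yb by rewrite abE.
have GbE : \sum_j yb 0 j * g j = G.
  by rewrite GE; apply: eq_bigr => n _; rewrite ybE gnE.
have fb k : (k < K)%N -> flux lambda p g gamma yb k = 0.
  move=> kK; rewrite /flux abE !ybE /departure GbE !inordK ?ltnS ?(ltnW kK) //.
  rewrite xflux // /gn (minn_idPl kK) subrr //.
have [Gam [_ GamP]] := cvg_seq_bounded (cvgP _ hM).
have mGam N : (M N)%:R / N%:R <= `|Gam| + 1.
  apply: le_trans (ler_norm _) _; apply: GamP => //.
  by rewrite (le_lt_trans (ler_norm _)) // ltrDl.
have Gam0 : 0 <= `|Gam| + 1 by rewrite addr_ge0.
have [C CP] := stationary_tail_estimate lambda p g K0 lambda0 p01 gmono g0 g_gt0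
  gamma yb (`|Gam| + 1) ybP yb_gt0 ab_gt0 fb Gam0.
exists yb; split.
- by split=> //; apply/drift_eq0.
- move=> z [zP /drift_eq0 fz].
  apply: (equilibrium_unique_pos lambda p g K0 lambda0 p01 gmono g0 g_gt0 gamma yb) => //.
  exact: (equilibrium_arrival_ge0 lambda p g K0 lambda0 p01 g0 g_gt0).
(* This choice makes [d] and [1/(N d)] equal. *)
pose d N : R := Num.sqrt N%:R^-1.
apply: (@converges_weakly_dirac R K ybarN yb (fun N => state K N (M N))
  (fun N => @profile R K N (M N))
  (fun N => 2 * (C * (d N + `|(M N)%:R / N%:R - gamma| + d N)))) => //.
  move=> N N0.
  have d0 : 0 < d N by rewrite sqrtr_gt0 invr_gt0 ltr0n.
  have dE : (N%:R * d N)^-1 = d N.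
    apply: (mulfI (lt0r_neq0 (mulr_gt0 (_ : 0 < N%:R) d0))); first by rewrite ltr0n.
    rewrite mulfV ?lt0r_neq0 ?mulr_gt0 ?ltr0n //.
    rewrite -mulrA -expr2 sqr_sqrtr ?invr_ge0 // mulfV // lt0r_neq0 // ltr0n //.
  have [_ inv] := hinv N N0.
  have := CP N (M N) (P N) (w N) (d N) N0 (mGam N) d0 (hP N N0) inv (w0 N) (w1 N N0).
  rewrite dE => H.
  apply: (@le_trans _ _ (2 * \sum_c w N c *
     (\sum_(i < K) `|tail (profile R c) i.+1 - tail yb i.+1|))).
    rewrite mulr_sumr; apply: ler_sum => c _; rewrite mulrCA.
    apply: ler_wpM2l; first exact: (w0 N c).
    by apply: norm_le_tails => //; exact: profile_prob_vec.
  by rewrite ler_wpM2l.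
have dcvg : d @ \oo --> 0.
  have Ncvg : N%:R^-1 @[N --> \oo] --> (0 : R).
    by rewrite -cvg_shiftS; exact: cvg_harmonic.
  by have := cvg_comp _ _ Ncvg (@sqrt_continuous R 0); rewrite sqrtr0.
have mcvg : `|(M N)%:R / N%:R - gamma| @[N --> \oo] --> (0 : R).
  have := cvg_norm (cvgB hM (cvg_cst gamma)); rewrite subrr normr0; exact.
have := cvgM (cvg_cst (2 : R)) (cvgM (cvg_cst C) (cvgD (cvgD dcvg mcvg) dcvg)).
by rewrite !addr0 !mulr0; exact.
Qed.

Theorem theorem4p3 (R : realType) (K : nat) (lambda p gamma : R)
    (g : 'I_K.+1 -> R) (M : nat -> nat)
    (P : forall N : nat, R -> state K N (M N) -> state K N (M N) -> R)
    (ybarN : nat -> probability (borel R K.+1) R)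
    (hK : (1 <= K)%N) (hlambda : 0 < lambda) (hp : 0 <= p <= 1)
    (hg_mono : forall m n : 'I_K.+1, (m <= n)%N -> g m <= g n)
    (hg_ge0 : forall n : 'I_K.+1, 0 <= g n)
    (* the ratio g(n) / sum_j y_j g(j) is never 0/0 with a nonzero factor *)
    (hg_wd : 0 < p -> forall n : 'I_K.+1, (0 < n)%N -> 0 < g n)
    (hM : (M N)%:R / N%:R @[N --> \oo] --> gamma)
    (* when g(0) = 0, an equilibrium exists only in these cases *)
    (hgamma : g ord0 = 0 -> gamma = 0 \/ p * lambda < gamma)
    (hP : forall N : nat, (0 < N)%N ->
       has_transition_rates (@state_rate R K lambda p g N (M N)) (P N))
    (hinv : forall N : nat, (0 < N)%N ->
       invariant_distribution (@profile R K N (M N)) (P N) (ybarN N)) :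
  exists ybar : 'rV[R]_K.+1,
    [/\ is_equilibrium lambda p gamma g ybar,
        forall z, is_equilibrium lambda p gamma g z -> z = ybar
      & converges_weakly ybarN (\d_(ybar : borel R K.+1))].
Proof.
have := hp; case/andP; rewrite le_eqVlt => /orP[/eqP p0 _|p_gt0 _]; last first.
  by apply: (mean_field_limit lambda p gamma g M P) => //; [exact: hg_wd | left].
(* For [p = 0] the departure rate is [lambda] at every level, whatever the choice function, and [g]
   may vanish. The constant function 1 gives the same chain and the same drift, and it has the
   positivity on which the estimates rest. *)
subst p.
have depE : departure lambda 0 g = departure lambda 0 (fun=> 1).
  by apply/funext => y; apply/funext => n; rewrite /departure !mul0r.
have driftE : drift lambda 0 gamma g = drift lambda 0 gamma (fun=> 1).
  by rewrite /drift depE.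
rewrite /is_equilibrium driftE.
apply: (mean_field_limit lambda 0 gamma (fun=> 1) M P) => //.
- by right.
- by move/eqP; rewrite oner_eq0.
- by move=> N N0; have := hP N N0; rewrite /state_rate /rate depE.
Qed.
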